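(* Suppose the problem data $\omega\mapsto(f(\cdot;\omega),g(\cdot;\omega),h(\cdot;\omega))$ of the parametric problem (P$_\omega$) is $C^2$ on a neighborhood $\Omega_0$ of $\omega^\star$, and that the KKT triple $(x^\star,\lambda^\star,\mu^\star)$ at $\omega^\star$ satisfies LICQ, SOSC and strict complementarity. Then there exist a neighborhood $U\subseteq\Omega_0$ of $\omega^\star$ and constants $\kappa,\eta_0>0$ such that: (a) (Strong regularity.) There is a unique $C^1$ map $\omega\mapsto(x^\star(\omega),\lambda^\star(\omega),\mu^\star(\omega))$ on $U$ satisfying the KKT conditions of (P$_\omega$) at $\omega$, with $$\|\lambda^\star(\omega)-\lambda^\star\|\le\kappa\|\omega-\omega^\star\|,\qquad\forall\omega\in U.$$ (b) (Constant regime.) If $\lambda^\star\in\mathcal{R}_r^\circ$ for some $r\in\{\mathrm{unc},\mathrm{res},\mathrm{sat},\mathrm{coup}\}$ and we set $$\eta:=\min\Bigl\{\eta_0,\ \frac{\rho_r(\lambda^\star)}{C_\Psi\,\kappa}\Bigr\},$$ where $C_\Psi$ is the (finite) joint Lipschitz constant of the feature map $\lambda\mapsto(L,\Sigma_k,\sigma_\delta,\tau)$ on a bounded neighborhood of $\lambda^\star$, then $$\Psi(\lambda^\star(\omega))=r,\qquad\forall\omega\in U\text{ with }\|\omega-\omega^\star\|<\eta.$$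
   Context: Problem (P$_\omega$), with data $\omega\in\Omega\subset\mathbb{R}^d$: minimize $f(x;\omega)$ over $x\in\mathbb{R}^n$ subject to $g_i(x;\omega)\le0$ ($i=1,\dots,m$), $h_j(x;\omega)=0$ ($j=1,\dots,p$), with $f,g_i,h_j$ at least $C^2$ jointly in $(x,\omega)$. Lagrangian: $\mathfrak{L}(x,\lambda,\mu;\omega)=f+\sum_i\lambda_ig_i+\sum_j\mu_jh_j$. A KKT triple $(x^\star,\lambda^\star,\mu^\star)\in\mathbb{R}^n\times\mathbb{R}^m_+\times\mathbb{R}^p$ satisfies $\nabla_x\mathfrak{L}=0$; $g_i\le0$, $\lambda_i^\star\ge0$, $\lambda_i^\star g_i=0$ for all $i$; $h_j=0$ for all $j$ (all at $x^\star$). Active set: $\mathcal{A}(x^\star)=\{i:g_i(x^\star)=0\}$. LICQ: $\{\nabla g_i(x^\star)\}_{i\in\mathcal{A}(x^\star)}\cup\{\nabla h_j(x^\star)\}_j$ are linearly independent. SOSC: $d^\top\nabla^2_{xx}\mathfrak{L}\,d>0$ for every nonzero $d$ with $\nabla g_i(x^\star)^\top d\le0$ for all $i\in\mathcal{A}(x^\star)$, $\nabla g_i(x^\star)^\top d=0$ for all $i$ with $\lambda_i^\star\neq0$, $\nabla h_j(x^\star)^\top d=0$ for all $j$. Strict complementarity: $\lambda_i^\star>0$ for every $i\in\mathcal{A}(x^\star)$. Features. For $\lambda\in\mathbb{R}^m_+$ let $L(\lambda)=\sum_i\lambda_i$; $\bar\lambda=\lambda/L(\lambda)$ if $L(\lambda)>0$,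 $\bar\lambda=0$ otherwise; $\bar\lambda_{(1)}\ge\cdots\ge\bar\lambda_{(m)}$ the sorted entries. Fix $\Theta=(\delta,\theta,\gamma,k)$ with $0<\delta<\tfrac12$, $\theta\in(\tfrac12,1)$, $\gamma\in(0,1)$, $k\in\{1,\dots,m-1\}$. $\Sigma_k(\lambda)=\sum_{j=1}^k\bar\lambda_{(j)}$, $\sigma_\delta(\lambda)=\frac1m|\{i:\bar\lambda_i>\delta\}|$, $\tau(\lambda)=\bar\lambda_{(2)}$. Core regimes in $\mathbb{R}^m_+$: $\mathcal{R}_{\mathrm{unc}}^\circ=\{L<\delta\}$; $\mathcal{R}_{\mathrm{res}}^\circ=\{L>\delta,\Sigma_k>\theta\}$; $\mathcal{R}_{\mathrm{sat}}^\circ=\{L>\delta,\Sigma_k<\theta,\sigma_\delta>\gamma\}$; $\mathcal{R}_{\mathrm{coup}}^\circ=\{L>\delta,\Sigma_k<\theta,\sigma_\delta<\gamma,\tau>\delta\}$. $\Psi(\lambda)$ is the unique $r\in\{\mathrm{unc},\mathrm{res},\mathrm{sat},\mathrm{coup}\}$ with $\lambda\in\mathcal{R}_r^\circ$ if it exists, and $\mathrm{hyb}$ otherwise. Margin: $\rho_r(\lambda^\star):=\operatorname{dist}(\lambda^\star,\partial\mathcal{R}_r^\circ)>0$, where $\partial\mathcal{R}_r^\circ$ is the topological boundary in $\mathbb{R}^m_+$.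
   Formalization: In (a), uniqueness is among C^1 KKT maps passing through the given triple at ω* (otherwise distant branches break it); in (b), finiteness of C_Ψ on the chosen bounded neighborhood is assumed, since it fails for some λ*, e.g. λ*=0. *)

(* Defs.v *)
From HB Require Import structures.
From mathcomp Require Import all_boot all_order all_algebra.
From mathcomp Require Import all_classical all_reals all_analysis.

Set Implicit Arguments.
Unset Strict Implicit.
Unset Printing Implicit Defensive.

Import Order.TTheory GRing.Theory Num.Theory.
Import numFieldNormedType.Exports.

Local Open Scope classical_set_scope.
Local Open Scope ring_scope.

(* The library norm on row vectors is the sup norm; all norms and distances in
   the statement are Euclidean. *)
Definition dotv (R : realType) (n : nat) (u v : 'rV[R]_n) : R :=
  \sum_(i < n) u 0 i * v 0 i.

Definition enorm (R : realType) (n : nat) (u : 'rV[R]_n) : R :=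
  Num.sqrt (dotv u u).

(* The real infimum of the empty set is 0, so this is the usual distance only
   for nonempty A. *)
Definition edist_to (R : realType) (n : nat) (u : 'rV[R]_n)
    (A : set 'rV[R]_n) : R :=
  inf [set enorm (u - v) | v in A].

(* The optimal Lipschitz constant of F on A, possibly +oo. *)
Definition lipschitz_const (R : realType) (n q : nat) (A : set 'rV[R]_n)
    (F : 'rV[R]_n -> 'rV[R]_q) : \bar R :=
  ereal_sup [set ((enorm (F z.1 - F z.2) / enorm (z.1 - z.2))%:E)%E
            | z in [set z | [/\ A z.1, A z.2 & z.1 <> z.2]]].

(* F is of class C^k on D, for an open D and a finite-dimensional V: there,
   continuity of the differential is the same as continuity of x |-> 'd F x v
   for every fixed v. *)
Fixpoint Ck (R : realType) (V W : normedModType R) (k : nat) (D : set V)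
    (F : V -> W) : Prop :=
  match k with
  | 0%N => forall x, D x -> {for x, continuous F}
  | k'.+1 => (forall x, D x -> differentiable F x) /\
             (forall v, Ck k' D (fun x => 'd F x v))
  end.

Definition grad (R : realType) (n : nat) (phi : 'rV[R]_n -> R)
    (x : 'rV[R]_n) : 'rV[R]_n :=
  \row_(i < n) 'D_(delta_mx 0 i) phi x.

Definition hess (R : realType) (n : nat) (phi : 'rV[R]_n -> R)
    (x : 'rV[R]_n) : 'M[R]_n :=
  \matrix_(i < n, j < n)
    'D_(delta_mx 0 i) (fun y => 'D_(delta_mx 0 j) phi y) x.

Record nlp (R : realType) (n m p d : nat) := NLP {
  objective : 'rV[R]_n -> 'rV[R]_d -> R;
  ineq : 'I_m -> 'rV[R]_n -> 'rV[R]_d -> R;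
  eqc : 'I_p -> 'rV[R]_n -> 'rV[R]_d -> R }.

Section NLP.
Variables (R : realType) (n m p d : nat) (P : nlp R n m p d).

(* Joint regularity in (x, omega) over R^n x D. *)
Definition nlp_Ck (k : nat) (D : set 'rV[R]_d) : Prop :=
  let D' := [set z : 'rV[R]_n * 'rV[R]_d | D z.2] in
  [/\ Ck k D' (fun z => objective P z.1 z.2),
      forall i, Ck k D' (fun z => ineq P i z.1 z.2) &
      forall j, Ck k D' (fun z => eqc P j z.1 z.2)].

Definition lagrangian (x : 'rV[R]_n) (la : 'rV[R]_m) (mu : 'rV[R]_p)
    (w : 'rV[R]_d) : R :=
  objective P x w + \sum_(i < m) la 0 i * ineq P i x w
                  + \sum_(j < p) mu 0 j * eqc P j x w.

Definition KKT (w : 'rV[R]_d) (z : 'rV[R]_n * 'rV[R]_m * 'rV[R]_p) : Prop :=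
  let: (x, la, mu) := z in
  [/\ grad (fun y => lagrangian y la mu w) x = 0,
      forall i, [/\ ineq P i x w <= 0, 0 <= la 0 i
                  & la 0 i * ineq P i x w = 0] &
      forall j, eqc P j x w = 0].

Definition active (w : 'rV[R]_d) (x : 'rV[R]_n) : {set 'I_m} :=
  [set i | ineq P i x w == 0]%SET.

Definition LICQ (w : 'rV[R]_d) (x : 'rV[R]_n) : Prop :=
  free ([seq grad (fun y => ineq P i y w) x | i <- enum (active w x)] ++
        [seq grad (fun y => eqc P j y w) x | j <- enum 'I_p]).

Definition SOSC (w : 'rV[R]_d) (z : 'rV[R]_n * 'rV[R]_m * 'rV[R]_p) : Prop :=
  let: (x, la, mu) := z in
  forall v : 'rV[R]_n, v != 0 ->
    (forall i, i \in active w x ->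
       dotv (grad (fun y => ineq P i y w) x) v <= 0) ->
    (forall i, la 0 i != 0 -> dotv (grad (fun y => ineq P i y w) x) v = 0) ->
    (forall j, dotv (grad (fun y => eqc P j y w) x) v = 0) ->
    0 < (v *m hess (fun y => lagrangian y la mu w) x *m v^T) 0 0.

Definition strict_complementarity (w : 'rV[R]_d) (x : 'rV[R]_n)
    (la : 'rV[R]_m) : Prop :=
  forall i, i \in active w x -> 0 < la 0 i.

End NLP.

Record params (R : realType) := Params {
  delta : R; theta : R; gamma : R; topk : nat }.

Definition admissible (R : realType) (m : nat) (T : params R) : Prop :=
  [/\ 0 < delta T < 2^-1, 2^-1 < theta T < 1, 0 < gamma T < 1
    & (0 < topk T < m)%N].

Inductive core_regime := unc | res | sat | coup.
Inductive regime := Core of core_regime | hyb.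

Section Features.
Variables (R : realType) (m : nat) (T : params R).
Implicit Type la : 'rV[R]_m.

Definition nonneg_orthant : set 'rV[R]_m := [set la | forall i, 0 <= la 0 i].

Definition Ltot la : R := \sum_(i < m) la 0 i.

Definition lbar la : 'rV[R]_m :=
  if 0 < Ltot la then (Ltot la)^-1 *: la else 0.

(* The j-th largest entry of lbar, counted from 1, is (lsorted la)`_j.-1. *)
Definition lsorted la : seq R := sort >=%R [seq lbar la 0 i | i <- enum 'I_m].

Definition Sigma la : R := \sum_(0 <= j < topk T) (lsorted la)`_j.

Definition sigma la : R :=
  #|[set i | delta T < lbar la 0 i]%SET|%:R / m%:R.

Definition tau la : R := (lsorted la)`_1.

Definition feature la : 'rV[R]_4 :=
  \row_(i < 4) [:: Ltot la; Sigma la; sigma la; tau la]`_i.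

Definition core_region (r : core_regime) : set 'rV[R]_m :=
  nonneg_orthant `&`
  match r with
  | unc => [set la | Ltot la < delta T]
  | res => [set la | delta T < Ltot la /\ theta T < Sigma la]
  | sat => [set la | [/\ delta T < Ltot la, Sigma la < theta T
                       & gamma T < sigma la]]
  | coup => [set la | [/\ delta T < Ltot la, Sigma la < theta T,
                          sigma la < gamma T & delta T < tau la]]
  end.

Definition Psi la : regime :=
  match pselect (exists! r, core_region r la) with
  | left H => Core (sval (cid H))
  | right _ => hyb
  end.

(* Boundary for the topology induced on the (closed) nonnegative orthant. *)
Definition orthant_boundary (A : set 'rV[R]_m) : set 'rV[R]_m :=
  nonneg_orthant `&` closure A `&` closure (nonneg_orthant `\` A).

(* When a core region is nonempty, its boundary is nonempty too, since the
   orthant is connected and no core region is all of it; so the margin at a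
   point of a core region is a genuine distance. *)
Definition margin (r : core_regime) la : R :=
  edist_to la (orthant_boundary (core_region r)).

End Features.

(* Main.v *)
Require Import Defs.
From HB Require Import structures.
From mathcomp Require Import all_boot all_order all_algebra.
From mathcomp Require Import all_classical all_reals all_analysis.
From mathcomp Require Import ring lra.

Import Order.TTheory GRing.Theory Num.Theory.
Import numFieldNormedType.Exports.

Local Open Scope classical_set_scope.
Local Open Scope ring_scope.

Set Implicit Arguments.
Unset Strict Implicit.
Unset Printing Implicit Defensive.

(** Near the given KKT triple the signs of the active multipliers and of the
inactive constraints persist, by strict complementarity. There the KKT
conditions are equivalent to a square system of equations: stationarity of the
Lagrangian, [g_i = 0] for each active [i], [la_i = 0] for each inactive [i],
and [h_j = 0] ([kktmap], [kktmap_eq0]). The system is C^1 because the data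
is C^2. A vector [(dx, dla, dmu)] in the kernel of its partial differential
satisfies [dx H dx^T = 0] with [dx] in the critical cone, so SOSC gives
[dx = 0] and then LICQ gives [dla = 0] and [dmu = 0]
([KKT_system_nondegenerate], [kktmap_regular]). The implicit function theorem
([implicit_function]) yields a C^1 branch of solutions with a linear bound
on its distance to the base point, and the solutions of the system in a fixed
tube around the base point are exactly the points of that branch. A second
KKT branch from the same base point starts in the tube; along a segment from
the base parameter it cannot leave, because by the intermediate value theorem
it would have to cross the shell between radius [r / 2] and [r], which contains
no solution ([branch_unique]).

The implicit function theorem is proved with the map
[G (z, w) = z - F (z, w) J^-1], whose partial differential in [z] vanishes at
the base point. By continuity and the mean value inequality it is a contraction
in [z], with ratio 1/2, over a product of balls. The fixed point [s w] is
continuous since [|s w - s w'| <= 2 |G (s w', w) - G (s w', w')|]. Its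
differential [u = 'd s w v] solves the linearised fixed point equation
[u = dG (u, v)], which is a contraction as well; the same inequality, applied
to linearised fixed points, gives both the remainder estimate and the
continuity of the differential, and [J] is the only operator to be inverted.

For the regimes, the four core regions are pairwise disjoint, so [Psi] takes
the value [r] on all of the region of [r]. A point of a core region which lies
on the relative boundary (possible because the feature [sigma] jumps) has
margin 0, and then [eta <= 0]. Any other point has a radius [e] within which
every nonnegative multiplier is in the same region; with
[eta0 = e / kappa] the linear bound keeps the multiplier of the branch inside
that radius. *)

(** * Norms, continuity and differentials *)

(** Row vectors are the space of unknowns for the fixed point theorem, which
needs a complete norm. *)
HB.instance Definition _ (R : realType) (m n : nat) :=
  Uniform_isComplete.Build 'M[R]_(m, n) (@mx_complete R m n).

Lemma rV_norm_le (R : realType) (n : nat) (u : 'rV[R]_n) (c : R) :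
  0 <= c -> (forall i, `|u 0 i| <= c) -> `|u| <= c.
Proof.
move=> c0 H; rewrite /Num.norm/= mx_normrE; apply/bigmax_leP; split => // -[i j] _ /=.
by rewrite ord1.
Qed.

Lemma rV_coord_le_norm (R : realType) (n : nat) (u : 'rV[R]_n) i :
  `|u 0 i| <= `|u|.
Proof.
rewrite [leRHS]/Num.norm/= mx_normrE.
exact: (@le_bigmax _ _ _ _ (fun ij : 'I_1 * 'I_n => `|u ij.1 ij.2|) (0, i)).
Qed.

Lemma row_mx_norm_le (R : realType) (a b : nat) (u : 'rV[R]_a) (v : 'rV[R]_b)
    (c : R) : `|u| <= c -> `|v| <= c -> `|row_mx u v| <= c.
Proof.
move=> uc vc; apply: rV_norm_le => [|i]; first exact: le_trans uc.
rewrite mxE; case: (fintype.split i) => k.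
  exact: le_trans (rV_coord_le_norm _ _) uc.
exact: le_trans (rV_coord_le_norm _ _) vc.
Qed.

Lemma pairDE (V W : zmodType) (a c : V) (b d : W) :
  (a, b) + (c, d) = (a + c, b + d).
Proof. by []. Qed.

Lemma pairBE (V W : zmodType) (a c : V) (b d : W) :
  (a, b) - (c, d) = (a - c, b - d).
Proof. by []. Qed.

Lemma pair_norm_le (R : realType) (V W : normedModType R) (a : V) (b : W)
    (c : R) : (`|(a, b)| <= c) = (`|a| <= c) && (`|b| <= c).
Proof. by rewrite prod_normE ge_max. Qed.

Lemma norm_pair0 (R : realType) (V W : normedModType R) (b : W) :
  `|((0 : V), b)| = `|b|.
Proof.
by rewrite prod_normE/= normr0; apply/max_idPr.
Qed.

Lemma cvg_addl0 (R : realType) (W : normedModType R) (w : W) :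
  (w + h) @[h --> (0 : W)] --> w.
Proof.
have : (w + h) @[h --> (0 : W)] --> w + 0.
  by apply: cvgD; [exact: cvg_cst|exact: cvg_id].
by rewrite addr0.
Qed.

Lemma cvg_pair0 (R : realType) (V W : normedModType R) :
  ((0 : V), h) @[h --> (0 : W)] --> ((0 : V), (0 : W)).
Proof. by apply: cvg_pair; [exact: cvg_cst|exact: cvg_id]. Qed.

Lemma linear_le_continuous (R : realType) (V W : normedModType R)
    (f : {linear V -> W}) (k : R) :
  (forall v, `|f v| <= k * `|v|) -> continuous f.
Proof.
move=> fk; apply: bounded_linear_continuous; apply/linear_boundedP.
exists k; split; first exact: num_real.
move=> r /ltW kr x; apply: le_trans (fk x) _; exact: ler_wpM2r.
Qed.

(** Linear maps on row vectors have operator norm at most the sum of the norms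
of the images of the basis vectors. Through this bound, continuity of
[p |-> 'd F p v] at each fixed [v] becomes continuity in operator norm. *)
Lemma rV_linear_le (R : realType) (N : nat) (V : normedModType R)
    (f : 'rV[R]_N -> V) : linear f ->
  forall v, `|f v| <= (\sum_(i < N) `|f (delta_mx 0 i)|) * `|v|.
Proof.
move=> flin v.
pose fL : {linear 'rV[R]_N -> V} := HB.pack f (GRing.isLinear.Build _ _ _ _ f flin).
rewrite -[f v]/(fL v) {1}[v]row_sum_delta linear_sum/=.
rewrite mulr_suml; apply: le_trans (ler_norm_sum _ _ _) _.
apply: ler_sum => i _; rewrite -[f (_ *: _)]/(fL (_ *: _)) linearZ/= normrZ mulrC.
by apply: ler_wpM2l => //; exact: rV_coord_le_norm.
Qed.

Lemma rV_linear_continuous (R : realType) (N : nat) (V : normedModType R)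
    (f : {linear 'rV[R]_N -> V}) : continuous f.
Proof.
by apply: (linear_le_continuous (rV_linear_le _)); exact: linearP.
Qed.

Lemma differentiable_expansion (R : realType) (V W : normedModType R)
    (f : V -> W) (x : V) : differentiable f x ->
  forall e, 0 < e ->
    \forall h \near (0 : V), `|f (x + h) - f x - 'd f x h| <= e * `|h|.
Proof.
move=> /diff_locallyP[_] /eqaddoP H e e0.
apply: filterS (H e e0) => h /=.
by rewrite !fctE/= [h + x]addrC opprD addrA.
Qed.

(** The converse of [differentiable_expansion]: an epsilon form of the
definition, which lets a differential be found by estimates on norms. *)
Lemma expansion_differentiable (R : realType) (V W : normedModType R)
    (f : V -> W) (df : {linear V -> W}) (x : V) :
  continuous df ->
  (forall e, 0 < e ->
    \forall h \near (0 : V), `|f (x + h) - f x - df h| <= e * `|h|) ->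
  differentiable f x /\ 'd f x = df :> (V -> W).
Proof.
move=> dfc H.
have E : f \o shift x = cst (f x) + df +o_ (0 : V) id.
  apply/eqaddoP => e e0; apply: filterS (H e e0) => h /=.
  by rewrite !fctE/= [h + x]addrC opprD addrA.
have D := diff_unique dfc E.
split; last exact: D.
by apply/diff_locallyP; rewrite D.
Qed.

Lemma diff_affine (R : realType) (U V W : normedModType R) (f : V -> W)
    (L : {linear U -> V}) (c : V) (u v : U) : continuous L ->
  differentiable f (c + L u) ->
  differentiable (fun y => f (c + L y)) u /\
  'd (fun y => f (c + L y)) u v = 'd f (c + L u) (L v).
Proof.
move=> cL df.
have dL : differentiable L u by exact: linear_differentiable.
have dcst : differentiable (fun _ : U => c) u by exact: differentiable_cst.
have dg : differentiable (fun y => c + L y) u by exact: (differentiableD dcst dL).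
have E : 'd (fun y => c + L y) u = L :> (U -> V).
  have -> : 'd (fun y => c + L y) u = 'd (fun _ : U => c) u \+ 'd L u :> (U -> V).
    exact: (diffD dcst dL).
  rewrite (diff_lin _ cL) diff_cst.
  by apply/funext => y; rewrite -[LHS]/(0 + L y) add0r.
split; first exact: (differentiable_comp dg df).
have -> : 'd (fun y => f (c + L y)) u = 'd f (c + L u) \o 'd (fun y => c + L y) u
    :> (U -> W) by exact: (diff_comp dg df).
by rewrite -[LHS]/('d f (c + L u) ('d (fun y => c + L y) u v)) E.
Qed.

Lemma partial_diff (R : realType) (V W Z : normedModType R) (f : V * W -> Z)
    (x v : V) (w : W) : differentiable f (x, w) ->
  differentiable (fun y => f (y, w)) x /\
  'd (fun y => f (y, w)) x v = 'd f (x, w) (v, 0).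
Proof.
pose i1 (y : V) : V * W := (y, 0).
have i1lin : linear i1.
  by move=> a y z; rewrite /i1 -[a *: (y, 0)]/(a *: y, a *: 0) scaler0 pairDE addr0.
pose L : {linear V -> (V * W)%type} := HB.pack i1 (GRing.isLinear.Build _ _ _ _ _ i1lin).
have cL : continuous L.
  by move=> y; apply: cvg_pair; [exact: cvg_id|exact: cvg_cst].
have E y : (y, w) = (0, w) + L y by rewrite pairDE add0r addr0.
rewrite [in X in X -> _]E => df.
have [] := diff_affine v cL df.
have -> : (fun y => f ((0, w) + L y)) = (fun y => f (y, w)).
  by apply/funext => y; rewrite -E.
by rewrite -E.
Qed.

(** A function affine along a line has the slope of that line as its
directional derivative. This avoids differentiating products where a function
is affine in some of its variables. *)
Lemma diff_affine_line (R : realType) (V : normedModType R) (f : V -> R)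
    (x u : V) (c : R) : differentiable f x ->
  (forall t : R, f (x + t *: u) = f x + t * c) -> 'd f x u = c.
Proof.
move=> df H; rewrite -deriveE// /derive; apply: cvg_lim => //.
have E : \forall t \near (0 : R)^', t^-1 *: (f (t *: u + x) - f x) = c.
  near=> t.
  have t0 : t != 0 by near: t; exact: nbhs_dnbhs_neq.
  by rewrite [t *: u + x]addrC H addrAC subrr add0r -[LHS]/(t^-1 * (t * c)) mulKf.
have C : cst c t @[t --> (0 : R)^'] --> c by exact: cvg_cst.
apply: cvg_trans C; apply: near_eq_cvg.
by apply: filterS E => t Et; exact/esym.
Unshelve. all: by end_near. Qed.

Lemma diff_coord (R : realType) (V : normedModType R) (N : nat)
    (f : V -> 'rV[R]_N) (x v : V) (i : 'I_N) : differentiable f x ->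
  differentiable (fun y => f y 0 i) x /\
  'd (fun y => f y 0 i) x v = 'd f x v 0 i.
Proof.
move=> df.
pose c (M : 'rV[R]_N) : R := M 0 i.
have clin : linear c by move=> a u w; rewrite /c !mxE.
pose cL : {linear 'rV[R]_N -> R} := HB.pack c (GRing.isLinear.Build _ _ _ _ c clin).
have cc : continuous cL by exact: coord_continuous.
split; first exact: (differentiable_comp df (differentiable_coord _ _ _)).
rewrite (_ : (fun y => f y 0 i) = cL \o f)// diff_comp//.
  by rewrite (diff_lin _ cc).
exact: linear_differentiable.
Qed.

Lemma mean_value_segment (R : realType) (V : normedModType R) (f : V -> R)
    (x y : V) :
  (forall t : R, 0 <= t <= 1 -> differentiable f (x + t *: (y - x))) ->
  exists2 t : R, 0 <= t <= 1 & f y - f x = 'd f (x + t *: (y - x)) (y - x).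
Proof.
move=> df.
pose g (t : R) : V := x + t *: (y - x).
have dg (t : R) : is_diff t g (fun s => s *: (y - x)).
  have -> : g = cst x + (fun s : R => s *: (y - x)) by [].
  apply: is_diff_eq.
  by rewrite add0r.
have dfg (t : R) : 0 <= t <= 1 ->
    is_derive t 1 (f \o g) ('d f (x + t *: (y - x)) (y - x)).
  move=> t01.
  have dg' : differentiable g t by [].
  have dfg' : differentiable (f \o g) t by apply: differentiable_comp => //; exact: df.
  split; first by apply/derivable1_diffP.
  rewrite deriveE// diff_comp//=; last exact: df.
  by rewrite diff_val scale1r.
have [] := @MVT_segment R (f \o g)
  (fun t : R => 'd f (x + t *: (y - x)) (y - x)) 0 1 ler01.
- move=> t; rewrite in_itv/= => /andP[t0 t1]; apply: dfg.
  by rewrite (ltW t0) (ltW t1).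
- apply: derivable_within_continuous => t; rewrite in_itv/= => t01.
  by have [] := dfg t t01.
- move=> t; rewrite in_itv/= => t01 E; exists t => //.
  move: E; rewrite /g/= scale1r scale0r addr0 subr0 mulr1 => <-.
  by rewrite [x + _]addrC subrK.
Qed.

(** The scalar mean value theorem applies to each coordinate separately, at a
point that depends on the coordinate; together the coordinatewise
bounds are a bound in the sup norm. *)
Lemma mean_value_inequality (R : realType) (V : normedModType R) (N : nat)
    (f : V -> 'rV[R]_N) (x y : V) (c : R) : 0 <= c ->
  (forall t : R, 0 <= t <= 1 -> differentiable f (x + t *: (y - x)) /\
    `|'d f (x + t *: (y - x)) (y - x)| <= c) ->
  `|f y - f x| <= c.
Proof.
move=> c0 H; apply: rV_norm_le => // i.
have [t t01 E] := @mean_value_segment R V (fun z => f z 0 i) x y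
  (fun t t01 => (diff_coord 0 i (H t t01).1).1).
rewrite !mxE E.
have [df le_c] := H t t01.
by rewrite (diff_coord (y - x) i df).2 (le_trans (rV_coord_le_norm _ _)).
Qed.

(** * Maps of class C^1 *)

Lemma continuous_for_eq (V W : topologicalType) (D : set V) (f g : V -> W)
    (x : V) : open D -> D x -> (forall y, D y -> f y = g y) ->
  {for x, continuous g} -> {for x, continuous f}.
Proof.
move=> oD Dx fg; rewrite /prop_for /continuous_at (fg _ Dx); apply: cvg_trans.
apply: near_eq_cvg; have : \forall y \near x, D y by exact: open_nbhs_nbhs.
by apply: filterS => y Dy; rewrite fg.
Qed.

(** The differential of [F] is only given by [F'] on [D], but [D] is open, so
continuity at a point of [D] transfers from [F' v] to [p |-> 'd F p v]. *)
Lemma C1_intro (R : realType) (V W : normedModType R) (D : set V)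
    (F : V -> W) (F' : V -> V -> W) :
  open D ->
  (forall x, D x -> differentiable F x /\ forall v, 'd F x v = F' v x) ->
  (forall v x, D x -> {for x, continuous (F' v)}) -> Ck 1 D F.
Proof.
move=> oD dF cF; split=> [x /dF[]//|v x Dx].
apply: (continuous_for_eq oD Dx _ (cF v x Dx)) => y Dy.
by have [_ ->] := dF y Dy.
Qed.

Lemma C1_lin (R : realType) (V W : normedModType R) (D : set V)
    (f : {linear V -> W}) : continuous f -> open D -> Ck 1 D f.
Proof.
move=> cf oD; apply: (C1_intro (F' := fun v _ => f v)) => // [x Dx|v x Dx].
  by split; [exact: linear_differentiable|move=> v; rewrite diff_lin].
exact: cvg_cst.
Qed.

Lemma C1_comp_linl (R : realType) (V W Z : normedModType R) (D : set V)
    (F : V -> W) (f : {linear W -> Z}) : continuous f -> open D ->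
  Ck 1 D F -> Ck 1 D (f \o F).
Proof.
move=> cf oD [dF cF].
apply: (C1_intro (F' := fun v x => f ('d F x v))) => // [x Dx|v x Dx].
  have df : differentiable f (F x) by exact: linear_differentiable.
  split; first by apply: differentiable_comp => //; exact: dF.
  move=> v; rewrite diff_comp//; last exact: dF.
  by rewrite (diff_lin _ cf).
by apply: (@continuous_comp _ _ _ (fun y => 'd F y v) f); [exact: cF|exact: cf].
Qed.

Lemma C1_comp_linr (R : realType) (V W Z : normedModType R) (D : set V)
    (E : set W) (f : {linear V -> W}) (F : W -> Z) : continuous f -> open D ->
  (forall x, D x -> E (f x)) -> Ck 1 E F -> Ck 1 D (F \o f).
Proof.
move=> cf oD DE [dF cF].
apply: (C1_intro (F' := fun v x => 'd F (f x) (f v))) => // [x Dx|v x Dx].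
  have df : differentiable f x by exact: linear_differentiable.
  split; first by apply: differentiable_comp => //; exact/dF/DE.
  move=> v; rewrite diff_comp//; last exact/dF/DE.
  by rewrite -[X in 'd F _ (X v)](diff_lin x cf).
apply: (@continuous_comp _ _ _ f (fun y => 'd F y (f v))); first exact: cf.
exact/cF/DE.
Qed.

Lemma C1D (R : realType) (V W : normedModType R) (D : set V) (F G : V -> W) :
  open D -> Ck 1 D F -> Ck 1 D G -> Ck 1 D (fun x => F x + G x).
Proof.
move=> oD [dF cF] [dG cG].
apply: (C1_intro (F' := fun v x => 'd F x v + 'd G x v)) => // [x Dx|v x Dx].
  have dFx := dF x Dx; have dGx := dG x Dx.
  split; first exact: differentiableD.
  by move=> v; rewrite -[X in X v]/('d (F \+ G) x : V -> W) diffD.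
by apply: cvgD; [exact: cF|exact: cG].
Qed.

(** The shape of [z - F (z, w) J^-1], for which the implicit function theorem
needs both the regularity and the value of the differential. *)
Lemma C1_linear_combination (R : realType) (V W Z : normedModType R)
    (D : set V) (f : {linear V -> Z}) (L : {linear W -> Z}) (F : V -> W) :
  continuous f -> continuous L -> open D -> Ck 1 D F ->
  Ck 1 D (fun x => f x + L (F x)) /\
  forall x v, D x -> 'd (fun x => f x + L (F x)) x v = f v + L ('d F x v).
Proof.
move=> cf cL oD C1F.
split; first exact: (C1D oD (C1_lin cf oD) (C1_comp_linl cL oD C1F)).
move=> x v Dx; have dF : differentiable F x by have [+ _] := C1F; exact.
have df : differentiable f x by exact: linear_differentiable.
have dL : differentiable L (F x) by exact: linear_differentiable.
have dLF : differentiable (L \o F) x by exact: differentiable_comp.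
have -> : 'd (fun x => f x + L (F x)) x = 'd f x \+ 'd (L \o F) x :> (V -> Z).
  exact: diffD.
rewrite -[LHS]/('d f x v + 'd (L \o F) x v) (diff_lin _ cf); congr (_ + _).
by rewrite diff_comp// (diff_lin _ cL).
Qed.

Lemma C1_cst (R : realType) (V W : normedModType R) (D : set V) (c : W) :
  open D -> Ck 1 D (fun _ => c).
Proof.
move=> oD; apply: (C1_intro (F' := fun _ _ => 0)) => // [x Dx|v x Dx].
  by split; [exact: differentiable_cst|move=> v; rewrite diff_cst].
exact: cvg_cst.
Qed.

Lemma C1_sum (R : realType) (V W : normedModType R) (D : set V) (I : Type)
    (l : seq I) (F : I -> V -> W) : open D -> (forall i, Ck 1 D (F i)) ->
  Ck 1 D (fun x => \sum_(i <- l) F i x).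
Proof.
move=> oD dF; elim: l => [|i l IH].
  by under [X in Ck 1 D X]funext do rewrite big_nil; exact: C1_cst.
by under [X in Ck 1 D X]funext do rewrite big_cons; exact: C1D.
Qed.

Lemma C1M (R : realType) (V : normedModType R) (D : set V) (F G : V -> R) :
  open D -> Ck 1 D F -> Ck 1 D G -> Ck 1 D (fun x => F x * G x).
Proof.
move=> oD [dF cF] [dG cG].
apply: (C1_intro (F' := fun v x => F x * 'd G x v + G x * 'd F x v))
  => // [x Dx|v x Dx].
  have dFx := dF x Dx; have dGx := dG x Dx.
  split; first exact: differentiableM.
  by move=> v; rewrite -[X in X v]/('d (F * G) x : V -> R) diffM.
apply: cvgD; apply: cvgM.
- exact/differentiable_continuous/dF.
- exact: cG.
- exact/differentiable_continuous/dG.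
- exact: cF.
Qed.

Lemma C1_row (R : realType) (V : normedModType R) (D : set V) (N : nat)
    (F : V -> 'rV[R]_N) : open D -> (forall i, Ck 1 D (fun x => F x 0 i)) ->
  Ck 1 D F.
Proof.
move=> oD dF.
have -> : F = fun x => \sum_(i < N) (F x 0 i) *: delta_mx 0 i.
  by apply/funext => x; rewrite -row_sum_delta.
apply: C1_sum => // i.
pose L (c : R) : 'rV[R]_N := c *: delta_mx 0 i.
have Llin : linear L by move=> a u v; rewrite /L scalerDl scalerA.
pose LL : {linear R -> 'rV[R]_N} := HB.pack L (GRing.isLinear.Build _ _ _ _ L Llin).
apply: (@C1_comp_linl R V _ _ D (fun x => F x 0 i) LL) => //.
by move=> x; apply: cvgZl; exact: cvg_id.
Qed.

Lemma C1_row_mx (R : realType) (V : normedModType R) (D : set V) (a b : nat)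
    (F : V -> 'rV[R]_a) (G : V -> 'rV[R]_b) :
  (forall i, Ck 1 D (fun x => F x 0 i)) ->
  (forall i, Ck 1 D (fun x => G x 0 i)) ->
  forall i, Ck 1 D (fun x => row_mx (F x) (G x) 0 i).
Proof.
move=> dF dG i.
by under [X in Ck 1 D X]funext do rewrite mxE; case: (fintype.split i).
Qed.

(** * Fixed points depending on a parameter *)

(** Banach's fixed point theorem for a plain function that maps [A] to
itself. *)
Lemma contraction_fixpoint (R : realType) (X : completeNormedModType R)
    (A : set X) (f : X -> X) (q : R) :
  0 <= q < 1 -> closed A -> A !=set0 -> (forall x, A x -> A (f x)) ->
  (forall x y, A x -> A y -> `|f x - f y| <= q * `|x - y|) ->
  exists2 x, A x & f x = x.
Proof.
move=> /andP[q0 q1] Acl A0 fA flip.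
have fAA : set_fun A A f by move=> x /fA.
pose g : {fun A >-> A} := HB.pack f (isFun.Build _ _ A A f fAA).
have [|//|//|x Ax fx] := @banach_fixed_point R X A g.
  exists (NngNum q0); split => //= -[x y] /= [Ax Ay]; exact: flip.
by exists x.
Qed.

(** A family [z |-> G (z, w)] of contractions of ratio 1/2 on the ball of radius
[r] around [z0]. The displacement of the centre is at most [r / 4], so the fixed
points stay at distance at most [r / 2] from it, well inside the ball. *)
Section ParametricContraction.
Variables (R : realType) (X : completeNormedModType R) (W : normedModType R).
Variables (G : X * W -> X) (D : set (X * W)) (z0 : X) (r : R) (U : set W).
Hypotheses (r_gt0 : 0 < r) (C1G : Ck 1 D G) (oU : open U).
Hypothesis BUD : forall z w, `|z - z0| <= r -> U w -> D (z, w).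
Hypothesis dG_half : forall z w v, `|z - z0| <= r -> U w ->
  `|'d G (z, w) (v, 0)| <= 2^-1 * `|v|.
Hypothesis G_half : forall z z' w, `|z - z0| <= r -> `|z' - z0| <= r -> U w ->
  `|G (z, w) - G (z', w)| <= 2^-1 * `|z - z'|.
Hypothesis G_z0 : forall w, U w -> `|G (z0, w) - z0| <= r / 4.

Lemma fixpoint_branch_exists : exists s : W -> X,
  forall w, U w -> `|s w - z0| <= r / 2 /\ G (s w, w) = s w.
Proof.
suff H w : exists z, U w -> `|z - z0| <= r / 2 /\ G (z, w) = z.
  by exists (fun w => projT1 (cid (H w))) => w; exact: projT2 (cid (H w)).
have [Uw|nUw] := pselect (U w); last by exists z0.
have r2 : 0 < r / 2 by rewrite divr_gt0.
have half01 : 0 <= (2^-1 : R) < 1 by apply/andP; split; lra.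
have le2 z : `|z - z0| <= r / 2 -> `|z - z0| <= r.
  by move=> /le_trans; apply; lra.
have [|||z Bz Gz] := @contraction_fixpoint R X (closed_ball z0 (r / 2))
    (fun z => G (z, w)) 2^-1 half01 (@closed_ball_closed _ _ _ _).
- by exists z0; exact: closed_ballxx.
- move=> z; rewrite closed_ballE// /closed_ball_/= distrC => Bz.
  rewrite distrC -(subrK (G (z0, w)) (G _)) -addrA.
  apply: le_trans (ler_normD _ _) _.
  have := G_half (le2 _ Bz) _ Uw; move=> /(_ z0); rewrite subrr normr0 => /(_ (ltW r_gt0)).
  have := G_z0 Uw; lra.
- move=> z z'; rewrite closed_ballE// /closed_ball_/= !(distrC z0) => Bz Bz'.
  by apply: G_half => //; exact: le2.
exists z => _; split; last exact: Gz.
by move: Bz; rewrite closed_ballE// /closed_ball_/= distrC.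
Qed.

Variable s : W -> X.
Hypothesis s_fix : forall w, U w -> `|s w - z0| <= r / 2 /\ G (s w, w) = s w.

Let s_ball w : U w -> `|s w - z0| <= r.
Proof. by move=> /s_fix[/le_trans + _]; apply; have := r_gt0; lra. Qed.

Lemma fixpoint_branch_unique z w : `|z - z0| <= r -> U w -> G (z, w) = z -> z = s w.
Proof.
move=> Bz Uw Gz; have [_ Gs] := s_fix Uw.
apply/eqP; rewrite -subr_eq0 -normr_le0.
have := G_half Bz (s_ball Uw) Uw; rewrite Gz Gs; lra.
Qed.

(** The triangle inequality through [G (s w', w)]: one leg is at most half of
the left-hand side and is absorbed. *)
Lemma fixpoint_branch_dist w w' : U w -> U w' ->
  `|s w - s w'| <= 2 * `|G (s w', w) - G (s w', w')|.
Proof.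
move=> Uw Uw'; have [_ Gs] := s_fix Uw; have [_ Gs'] := s_fix Uw'.
rewrite Gs'.
have := G_half (s_ball Uw) (s_ball Uw') Uw; rewrite Gs.
have := ler_distD (G (s w', w)) (s w) (s w'); lra.
Qed.

Lemma fixpoint_branch_lipschitz_at w : U w ->
  exists2 k, 0 < k & \forall h \near (0 : W), `|s (w + h) - s w| <= k * `|h|.
Proof.
move=> Uw; have [dG _] := C1G.
have dGp := dG _ (BUD (s_ball Uw) Uw).
have [K K0 HK] := linear_lipschitz (diff_continuous dGp).
exists (2 * (K + 1)); first by rewrite mulr_gt0// addr_gt0.
have N1 : \forall h \near (0 : W), U (w + h).
  by have := @cvg_addl0 R W w; apply; exact: open_nbhs_nbhs.
have N2 : \forall h \near (0 : W),
    `|G ((s w, w) + (0, h)) - G (s w, w) - 'd G (s w, w) (0, h)| <= 1 * `|((0 : X), h)|.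
  have C := @cvg_pair0 R X W.
  exact: (C _ (differentiable_expansion dGp ltr01)).
near=> h.
have Uh : U (w + h) by near: h.
apply: le_trans (fixpoint_branch_dist Uh Uw) _.
have -> : (s w, w + h) = (s w, w) + (0, h) by rewrite pairDE addr0.
rewrite -mulrA ler_pM2l//.
have B2 : `|G ((s w, w) + (0, h)) - G (s w, w) - 'd G (s w, w) (0, h)|
    <= 1 * `|((0 : X), h)| by near: h.
have B1 := HK (0, h).
rewrite norm_pair0 in B1 B2.
rewrite -[X in `|X|](subrK ('d G (s w, w) (0, h))).
apply: le_trans (ler_normD _ _) _; lra.
Unshelve. all: by end_near. Qed.

Lemma fixpoint_branch_continuous w : U w -> {for w, continuous s}.
Proof.
move=> Uw; have [k k0 H] := fixpoint_branch_lipschitz_at Uw.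
apply/cvgrPdist_le => e e0.
suff : \forall h \near (0 : W), `|s w - s (h + (w - 0))| <= e.
  by rewrite -(near_shift 0 w (fun x => `|s w - s x| <= e)).
near=> h.
rewrite subr0 [h + w]addrC distrC; apply: (@le_trans _ _ (k * `|h|)); first by near: h.
rewrite -ler_pdivlMl//.
by near: h; apply: nbhs0_le; rewrite mulr_gt0// invr_gt0.
Unshelve. all: by end_near. Qed.

Lemma linearized_fixpoint_exists w v : U w ->
  exists u, u = 'd G (s w, w) (u, v).
Proof.
move=> Uw; pose B u := 'd G (s w, w) (u, v).
have [||||u _ Bu] := @contraction_fixpoint R X setT B 2^-1 _ closedT.
- by apply/andP; split; lra.
- by exists 0.
- by [].
- move=> u u' _ _; rewrite /B -linearB/=.
  have -> : (u, v) - (u', v) = (u - u', 0) by rewrite pairBE subrr.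
  exact: dG_half (s_ball Uw) Uw.
by exists u.
Qed.

(** The map [u |-> 'd G (s w, w) (u, 0)] halves norms, so an approximate
solution of a linearised equation is within twice its defect of the exact one.
This replaces the inversion of [1 - dG/dz]. *)
Lemma linearized_fixpoint_bound w u q : U w ->
  `|u - 'd G (s w, w) (u, 0)| <= q -> `|u| <= 2 * q.
Proof.
move=> Uw Hq; have := dG_half u (s_ball Uw) Uw.
have := ler_normD (u - 'd G (s w, w) (u, 0)) ('d G (s w, w) (u, 0)).
rewrite subrK; lra.
Qed.

(** The candidate differential sends [v] to the solution [L v] of
[u = 'd G (s w, w) (u, v)]. The increment of [s] solves the same equation up to
the remainder of [G], which is small compared with [h] because the increment is
of the order of [h]; [linearized_fixpoint_bound] turns that defect into the
required remainder of [s]. *)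
Lemma fixpoint_branch_differentiable (w : W) : U w -> differentiable s w /\
  forall v, 'd s w v = 'd G (s w, w) ('d s w v, v).
Proof.
move=> Uw; set B := 'd G (s w, w).
have dGp : differentiable G (s w, w) by have [dG _] := C1G; exact: dG _ (BUD (s_ball Uw) Uw).
have [L HL] : exists L : W -> X, forall v, L v = B (L v, v).
  exists (fun v => projT1 (cid (linearized_fixpoint_exists v Uw))) => v.
  exact: projT2 (cid (linearized_fixpoint_exists v Uw)).
have Luniq u v q : `|u - B (u, v)| <= q -> `|u - L v| <= 2 * q.
  move=> Hu; apply: (linearized_fixpoint_bound Uw); rewrite -/B.
  have -> : u - L v - B (u - L v, 0) = u - B (u, v).
    have -> : (u - L v, (0 : W)) = (u, v) - (L v, v) by rewrite pairBE subrr.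
    by rewrite linearB/= -HL opprB addrA subrK.
  exact: Hu.
have Lsol u v : u = B (u, v) -> u = L v.
  move=> Hu; apply/eqP; rewrite -subr_eq0 -normr_le0 -(mulr0 2).
  by apply: Luniq; rewrite -Hu subrr normr0.
have Llin : linear L.
  move=> a v v'; apply/esym/Lsol.
  by rewrite {1}HL {1}(HL v') -linearP.
pose LL : {linear W -> X} := HB.pack L (GRing.isLinear.Build _ _ _ _ L Llin).
have [K K0 HK] := linear_lipschitz (diff_continuous dGp).
have Lc : continuous LL.
  apply: (@linear_le_continuous _ _ _ _ (2 * K)) => v /=.
  rewrite -mulrA; apply: (linearized_fixpoint_bound Uw); rewrite -/B.
  have -> : L v - B (L v, 0) = B (0, v).
    rewrite {1}HL -linearB/=; congr (B _).
    by rewrite pairBE subrr subr0.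
  by apply: le_trans (HK _) _; rewrite norm_pair0.
have [k k0 Hk] := fixpoint_branch_lipschitz_at Uw.
have [ds dsE] : differentiable s w /\ 'd s w = LL :> (W -> X).
  apply: expansion_differentiable => // e e0.
  (* The increment (s (w + h) - s w, h) has norm at most (k + 1) |h|, and the
     defect is doubled. *)
  pose e' := e / (2 * (k + 1)).
  have k1 : 0 < 2 * (k + 1) by rewrite mulr_gt0// addr_gt0.
  have e'0 : 0 < e' by rewrite divr_gt0.
  have N1 : \forall h \near (0 : W), U (w + h).
    by have := @cvg_addl0 R W w; apply; exact: open_nbhs_nbhs.
  pose dl h : X * W := (s (w + h) - s w, h).
  have N2 : \forall h \near (0 : W),
      `|G ((s w, w) + dl h) - G (s w, w) - B (dl h)| <= e' * `|dl h|.
    have C : dl h @[h --> (0 : W)] --> ((0 : X), (0 : W)).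
      apply: cvg_pair; last exact: cvg_id.
      rewrite -(subrr (s w)); apply: cvgB; last exact: cvg_cst.
      apply: (@cvg_comp _ _ _ (fun h => w + h) s _ (nbhs w)).
        exact: cvg_addl0.
      exact: fixpoint_branch_continuous.
    exact: (C _ (differentiable_expansion dGp e'0)).
  near=> h => /=.
  have Uh : U (w + h) by near: h.
  have Gr : `|s (w + h) - s w| <= k * `|h| by near: h.
  have Hr : `|G ((s w, w) + dl h) - G (s w, w) - B (dl h)| <= e' * `|dl h| by near: h.
  have dl_le : `|dl h| <= (k + 1) * `|h|.
    have h0 : 0 <= `|h| by [].
    rewrite pair_norm_le; apply/andP; split; nra.
  have := Luniq (s (w + h) - s w) h (e' * ((k + 1) * `|h|)) => /(_ _)/le_trans; apply.
    have [_ Gs] := s_fix Uw; have [_ Gsh] := s_fix Uh.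
    move: Hr; rewrite /dl pairDE [s w + _]addrC subrK Gs Gsh => /le_trans; apply.
    by rewrite ler_pM2l.
  have E : e' * (2 * (k + 1)) = e by rewrite /e' divfK// gt_eqF.
  by rewrite -[in leRHS]E; lra.
split => // v; rewrite dsE/=; exact: HL.
Unshelve. all: by end_near. Qed.

(** For a fixed [v], the vectors ['d s w v] and ['d s w' v] solve linearised
equations with the coefficients of [w] and of [w']. Only the defect of one of
the two solutions in the other equation has to be small, so pointwise
continuity of the differential of [G] suffices. *)
Lemma fixpoint_branch_C1 : Ck 1 U s.
Proof.
split=> [w Uw|v w Uw]; first by have [] := fixpoint_branch_differentiable Uw.
have [_ C1G'] := C1G.
have [_ Ew] := fixpoint_branch_differentiable Uw.
set u := 'd s w v in Ew *.
have cu : {for w, continuous (fun w' => 'd G (s w', w') (u, v))}.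
  apply: (@continuous_comp _ _ _ (fun w' => (s w', w')) (fun p => 'd G p (u, v))).
    by apply: cvg_pair; [exact: fixpoint_branch_continuous|exact: cvg_id].
  exact: C1G' _ _ (BUD (s_ball Uw) Uw).
apply/cvgrPdist_le => e e0.
have e2 : 0 < e / 2 by rewrite divr_gt0.
have Uw' : \forall w' \near w, U w' by exact: open_nbhs_nbhs.
move/cvgrPdist_le: cu => /(_ _ e2) => cu.
near=> w'.
have Uw0 : U w' by near: w'.
have [_ Ew'] := fixpoint_branch_differentiable Uw0.
have : `|'d G (s w, w) (u, v) - 'd G (s w', w') (u, v)| <= e / 2 by near: w'.
rewrite -Ew -/u => H.
have -> : e = 2 * (e / 2) by rewrite mulrC divfK.
apply: (linearized_fixpoint_bound Uw0).
have -> : u - 'd s w' v - 'd G (s w', w') (u - 'd s w' v, 0)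
    = u - 'd G (s w', w') (u, v).
  have -> : (u - 'd s w' v, (0 : W)) = (u, v) - ('d s w' v, v) by rewrite pairBE subrr.
  by rewrite linearB/= -Ew' opprB addrA subrK.
exact: H.
Unshelve. all: by end_near. Qed.
End ParametricContraction.

(** * Implicit function theorem *)

(** The partial differential of [G] in [z] vanishes at the base point, so by
continuity it has norm at most 1/2 on a product of balls, and by the mean value
inequality [G] is then a contraction in [z]. The set [O] is any neighbourhood in
which the product of balls has to fit. *)
Lemma implicit_contraction (R : realType) (N : nat) (W : normedModType R)
    (G : 'rV[R]_N * W -> 'rV[R]_N) (D O : set ('rV[R]_N * W))
    (z0 : 'rV[R]_N) (w0 : W) :
  open D -> Ck 1 D G -> D (z0, w0) -> nbhs (z0, w0) O ->
  G (z0, w0) = z0 -> (forall v, 'd G (z0, w0) (v, 0) = 0) ->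
  exists (r rho K : R) (s : W -> 'rV[R]_N),
    [/\ 0 < r, 0 < rho, 0 < K & Ck 1 (ball w0 rho) s] /\
    [/\ s w0 = z0,
        forall z w, `|z - z0| <= r -> ball w0 rho w -> O (z, w) /\ D (z, w),
        forall w, ball w0 rho w ->
          `|s w - z0| <= r / 2 /\ G (s w, w) = s w,
        forall z w, `|z - z0| <= r -> ball w0 rho w -> G (z, w) = z -> z = s w &
        forall w, ball w0 rho w -> `|s w - z0| <= K * `|w - w0|].
Proof.
move=> oD C1G D0 O0 G0 dG0; have [dG cG] := C1G.
(* [B p] bounds the operator norm of the partial differential in z. *)
pose B (p : 'rV[R]_N * W) := \sum_(i < N) `|'d G p (delta_mx 0 i, 0)|.
have B_le z w v : `|'d G (z, w) (v, 0)| <= B (z, w) * `|v|.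
  apply: (@rV_linear_le R N _ (fun v => 'd G (z, w) (v, 0))) => a x y.
  rewrite -linearP; congr ('d G (z, w) _).
  by rewrite -[a *: (x, 0)]/(a *: x, a *: 0) pairDE scaler0 addr0.
have cB : {for (z0, w0), continuous B}.
  rewrite /prop_for /continuous_at /B.
  apply: cvg_big => [|i _]; first exact: add_continuous.
  by apply: cvg_norm; exact: cG.
have B0 : B (z0, w0) = 0.
  by rewrite /B big1// => i _; rewrite dG0 normr0.
have NB : \forall p \near (z0, w0), [/\ O p, D p & B p <= 2^-1].
  near=> p; split; first by near: p.
    by near: p; apply: open_nbhs_nbhs.
  near: p; move/cvgrPdist_le: cB => /(_ 2^-1) -/(_ ltac:(by rewrite invr_gt0)).
  apply: filterS => p; rewrite B0 sub0r normrN; apply: le_trans.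
  exact: ler_norm.
have [[P Q] /= [/nbhs_normP[r1 /= r10 HP] /nbhs_normP[r2 /= r20 HQ]] HPQ] := NB.
(* Half of [r1], so that the closed ball of radius [r] fits in the open one. *)
pose r := r1 / 2; have r0 : 0 < r by rewrite divr_gt0.
have BP z : `|z - z0| <= r -> P z.
  by move=> zr; apply: HP => /=; rewrite /ball_/= distrC (le_lt_trans zr)// /r; lra.
have dG00 := dG _ D0.
have [K K0 HK] := linear_lipschitz (diff_continuous dG00).
have NG : \forall h \near (0 : W), `|G (z0, w0 + h) - z0| <= (K + 1) * `|h|.
  have C : ((0 : 'rV[R]_N), h) @[h --> (0 : W)] --> ((0 : 'rV[R]_N), (0 : W)).
    exact: cvg_pair0.
  have H0 : \forall h \near (0 : W),
      `|G ((z0, w0) + (0, h)) - G (z0, w0) - 'd G (z0, w0) (0, h)|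
        <= 1 * `|((0 : 'rV[R]_N), h)|.
    exact: (C _ (differentiable_expansion dG00 ltr01)).
  apply: filterS H0 => h /=.
  rewrite pairDE addr0 G0 norm_pair0 => H.
  have := HK (0, h); rewrite norm_pair0 => H'.
  rewrite -[X in `|X|](subrK ('d G (z0, w0) (0, h))).
  apply: le_trans (ler_normD _ _) _; lra.
have [r3 /= r30 HG] := (nbhs_normP _ _).1 NG.
have K1 : 0 < K + 1 by rewrite addr_gt0.
have rK : 0 < r / 4 / (K + 1) by rewrite !divr_gt0.
(* The last bound makes the displacement of [z0] at most [r / 4]. *)
pose rho := Num.min r2 (Num.min r3 (r / 4 / (K + 1))).
have rho0 : 0 < rho by rewrite !lt_min r20 r30.
have Uw w : ball w0 rho w -> [/\ Q w, `|G (z0, w) - z0| <= (K + 1) * `|w - w0| &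
    `|w - w0| <= r / 4 / (K + 1)].
  rewrite -ball_normE/= !lt_min => /and3P[w2 w3 wK]; split.
  - exact: HQ.
  - have -> : G (z0, w) = G (z0, w0 + (w - w0)) by rewrite [w0 + _]addrC subrK.
    by apply: HG => /=; rewrite /ball_/= sub0r normrN distrC.
  - by rewrite distrC ltW.
pose U := ball w0 rho.
have oU : open U by exact: ball_open.
have BUD z w : `|z - z0| <= r -> U w -> D (z, w).
  by move=> /BP Pz /Uw[Qw _ _]; have [] := HPQ (z, w) (conj Pz Qw).
have dG_half z w v : `|z - z0| <= r -> U w ->
    `|'d G (z, w) (v, 0)| <= 2^-1 * `|v|.
  move=> /BP Pz /Uw[Qw _ _]; have [_ _ Bh] := HPQ (z, w) (conj Pz Qw).
  by apply: le_trans (B_le z w v) _; exact: ler_wpM2r.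
have G_half z z' w : `|z - z0| <= r -> `|z' - z0| <= r -> U w ->
    `|G (z, w) - G (z', w)| <= 2^-1 * `|z - z'|.
  move=> Bz Bz' Uw0; apply: mean_value_inequality; first by rewrite mulr_ge0.
  move=> t /andP[t0 t1].
  rewrite pairBE subrr -[t *: (_, _)]/(t *: (z - z'), t *: 0) scaler0 pairDE addr0.
  have Bt : `|z' + t *: (z - z') - z0| <= r.
    have -> : z' + t *: (z - z') - z0 = (1 - t) *: (z' - z0) + t *: (z - z0).
      by apply/rowP => i; rewrite !mxE; ring.
    apply: le_trans (ler_normD _ _) _; rewrite !normrZ.
    rewrite (ger0_norm t0) ger0_norm ?subr_ge0//.
    nra.
  by split; [exact/dG/BUD|exact: dG_half].
have G_z0 w : U w -> `|G (z0, w) - z0| <= r / 4.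
  move=> /Uw[_ H1 H2]; apply: le_trans H1 _.
  by rewrite mulrC -ler_pdivlMr.
have [s s_fix] := fixpoint_branch_exists r0 G_half G_z0.
have Uw0 : U w0 by exact: ballxx.
exists r, rho, (2 * (K + 1)), s; split; split => //.
- by rewrite mulr_gt0.
- exact: (fixpoint_branch_C1 r0 C1G oU BUD dG_half G_half s_fix).
- apply/esym/(fixpoint_branch_unique r0 G_half s_fix) => //.
  by rewrite subrr normr0 ltW.
- move=> z w Bz Uw1; split; last exact: BUD.
  by have [Qw _ _] := Uw _ Uw1; have [] := HPQ (z, w) (conj (BP _ Bz) Qw).
- exact: (fixpoint_branch_unique r0 G_half s_fix).
- move=> w Uw1; have [_ H1 _] := Uw _ Uw1.
  have sw0 : s w0 = z0.
    apply/esym/(fixpoint_branch_unique r0 G_half s_fix) => //.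
    by rewrite subrr normr0 ltW.
  have := fixpoint_branch_dist r0 G_half s_fix Uw1 Uw0; rewrite sw0 G0.
  move=> /le_trans; apply; rewrite -mulrA ler_pM2l//.
Unshelve. all: by end_near. Qed.

(** Newton's map [z - F (z, w) J^-1] with the Jacobian [J] frozen at the base
point has the zeros of [F] as its fixed points, and its partial differential
vanishes there. *)
Lemma implicit_function (R : realType) (N : nat) (W : normedModType R)
    (F : 'rV[R]_N * W -> 'rV[R]_N) (D O : set ('rV[R]_N * W))
    (z0 : 'rV[R]_N) (w0 : W) :
  open D -> Ck 1 D F -> D (z0, w0) -> nbhs (z0, w0) O ->
  F (z0, w0) = 0 -> (forall v, 'd F (z0, w0) (v, 0) = 0 -> v = 0) ->
  exists (r rho K : R) (s : W -> 'rV[R]_N),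
    [/\ 0 < r, 0 < rho, 0 < K & Ck 1 (ball w0 rho) s] /\
    [/\ s w0 = z0,
        forall z w, `|z - z0| <= r -> ball w0 rho w -> O (z, w) /\ D (z, w),
        forall w, ball w0 rho w ->
          `|s w - z0| <= r / 2 /\ F (s w, w) = 0,
        forall z w, `|z - z0| <= r -> ball w0 rho w -> F (z, w) = 0 -> z = s w &
        forall w, ball w0 rho w -> `|s w - z0| <= K * `|w - w0|].
Proof.
move=> oD C1F D0 O0 F0 dF_inj; have [dF _] := C1F.
have dF0 := dF _ D0.
pose j (v : 'rV[R]_N) := 'd F (z0, w0) (v, 0).
have jlin : linear j.
  move=> a x y; rewrite -linearP; congr ('d F (z0, w0) _).
  by rewrite -[a *: (x, 0)]/(a *: x, a *: 0) pairDE scaler0 addr0.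
pose jL : {linear 'rV[R]_N -> 'rV[R]_N} :=
  HB.pack j (GRing.isLinear.Build _ _ _ _ j jlin).
pose J := lin1_mx jL.
have JE v : v *m J = 'd F (z0, w0) (v, 0) by rewrite mul_rV_lin1.
have Junit : J \in unitmx.
  rewrite -row_free_unit; apply: inj_row_free => v.
  by rewrite JE; exact: dF_inj.
pose M := - invmx J.
have p1lin : linear (@fst 'rV[R]_N W) by [].
pose p1 : {linear ('rV[R]_N * W)%type -> 'rV[R]_N} :=
  HB.pack (@fst 'rV[R]_N W) (GRing.isLinear.Build _ _ _ _ _ p1lin).
have cp1 : continuous p1 by move=> p; exact: cvg_fst.
have cM : continuous (mulmxr M : {linear 'rV[R]_N -> 'rV[R]_N}).
  exact: rV_linear_continuous.
pose L : {linear 'rV[R]_N -> 'rV[R]_N} := mulmxr M.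
pose G p := p1 p + L (F p).
have [C1G dG] := C1_linear_combination cp1 cM oD C1F.
have G0E z w : F (z, w) = 0 <-> G (z, w) = z.
  rewrite /G /L/=; split=> [->|]; first by rewrite mul0mx addr0.
  rewrite -[RHS]addr0 => /addrI; rewrite /M mulmxN => /eqP; rewrite oppr_eq0 => /eqP.
  by move=> /(congr1 (mulmx^~ J)); rewrite mulmxKV// mul0mx.
have dG0 v : 'd G (z0, w0) (v, 0) = 0.
  by rewrite /G dG// -JE /p1 /L -[LHS]/(v + v *m J *m M) /M mulmxN mulmxK// subrr.
have [r [rho [K [s [H [s0 HO Hs Hu HK]]]]]] :=
  implicit_contraction oD C1G D0 O0 ((G0E _ _).1 F0) dG0.
exists r, rho, K, s; split => //; split => // [w Bw|z w zr Bw Fz].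
  by have [? /G0E] := Hs _ Bw.
by apply: Hu => //; exact/G0E.
Qed.

(** Solutions in the tube of radius [r] lie on [s], hence at distance at most
[r / 2] from [z0]. A continuous branch of solutions which starts at [z0] and
leaves the tube would pass through distance [3 / 4 * r] on the way. *)
Lemma branch_unique (R : realType) (V W : normedModType R)
    (P : V -> W -> Prop) (s s' : W -> V) (z0 : V) (w0 : W) (r rho : R) :
  0 < r ->
  (forall w, ball w0 rho w -> `|s w - z0| <= r / 2) ->
  (forall z w, `|z - z0| <= r -> ball w0 rho w -> P z w -> z = s w) ->
  (forall w, ball w0 rho w -> {for w, continuous s'}) -> s' w0 = z0 ->
  (forall w, ball w0 rho w -> P (s' w) w) ->
  forall w, ball w0 rho w -> s' w = s w.
Proof.
move=> r0 s_le Puniq cs' s'0 Ps' w Bw.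
have [le_r|gt_r] := leP `|s' w - z0| r; first by apply: Puniq => //; exact: Ps'.
pose g (t : R) : W := w0 + t *: (w - w0).
have Bg t : 0 <= t <= 1 -> ball w0 rho (g t).
  move=> /andP[t0 t1]; rewrite -ball_normE/= /g opprD addNKr normrN normrZ.
  rewrite ger0_norm//; apply: le_lt_trans (ler_piMl _ t1) _ => //.
  by move: Bw; rewrite -ball_normE/= distrC.
have cg : continuous g.
  by move=> t; apply: cvgD; [exact: cvg_cst|apply: cvgZl; exact: cvg_id].
pose phi t := `|s' (g t) - z0|.
have [||c] := @IVT R phi 0 1 (3 / 4 * r) ler01.
- apply: continuous_in_subspaceT => t; rewrite inE/= in_itv/= => t01.
  apply: cvg_norm; apply: cvgB; last exact: cvg_cst.
  by apply: (@continuous_comp _ _ _ g s'); [exact: cg|exact/cs'/Bg].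
- rewrite /phi /g scale0r addr0 scale1r [w0 + _]addrC subrK s'0 subrr normr0.
  by rewrite min_l ?max_r//; apply/andP; split; lra.
rewrite in_itv/= => /Bg Bc phic.
have E : s' (g c) = s (g c).
  by apply: Puniq => //; [rewrite -/(phi c) phic; lra|exact: Ps'].
by exfalso; have := s_le _ Bc; rewrite -E -/(phi c) phic; lra.
Qed.

(** * The KKT conditions as a system of equations *)

(** The shape of the Lagrangian as a function of the decision variable
alone, the multipliers being frozen coefficients. *)
Lemma derive_lagrange (R : realType) (V : normedModType R) (m p : nat)
    (f : V -> R) (g : 'I_m -> V -> R) (h : 'I_p -> V -> R)
    (c : 'I_m -> R) (e : 'I_p -> R) (x v : V) :
  differentiable f x -> (forall i, differentiable (g i) x) ->
  (forall j, differentiable (h j) x) ->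
  'D_v (fun y => f y + \sum_(i < m) c i * g i y + \sum_(j < p) e j * h j y) x =
  'd f x v + \sum_(i < m) c i * 'd (g i) x v + \sum_(j < p) e j * 'd (h j) x v.
Proof.
move=> df dg dh.
have -> : (fun y => f y + \sum_(i < m) c i * g i y + \sum_(j < p) e j * h j y) =
    f + \sum_(i < m) (c i *: g i) + \sum_(j < p) (e j *: h j).
  by apply/funext => y; rewrite !fctE !fct_sumE.
have H : is_derive x v (f + \sum_(i < m) (c i *: g i) + \sum_(j < p) (e j *: h j))
  ('d f x v + \sum_(i < m) c i *: 'd (g i) x v + \sum_(j < p) e j *: 'd (h j) x v).
  have D F : differentiable F x -> is_derive x v F ('d F x v).
    by move=> dF; split; [exact: diff_derivable|rewrite deriveE].
  apply: is_deriveD; first apply: is_deriveD.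
  - exact: D.
  - by apply: is_derive_sum => i; apply: is_deriveZ; exact: D.
  - by apply: is_derive_sum => i; apply: is_deriveZ; exact: D.
by have [_ ->] := H.
Qed.

Definition cylinder (V W : Type) (D : set W) : set (V * W) := [set q | D q.2].

Section KKTSystem.
Variables (R : realType) (n m p d : nat) (P : nlp R n m p d).
Local Notation N := (n + m + p)%N.

(** The implicit function theorem is stated for one row vector of unknowns, so a
triple is stored as a single row. *)
Definition pack (x : 'rV[R]_n) (la : 'rV[R]_m) (mu : 'rV[R]_p) : 'rV[R]_N :=
  row_mx (row_mx x la) mu.
Definition xpart (z : 'rV[R]_N) : 'rV[R]_n := lsubmx (lsubmx z).
Definition lapart (z : 'rV[R]_N) : 'rV[R]_m := rsubmx (lsubmx z).
Definition mupart (z : 'rV[R]_N) : 'rV[R]_p := rsubmx z.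

Lemma xpart_pack x la mu : xpart (pack x la mu) = x.
Proof. by rewrite /xpart /pack !row_mxKl. Qed.
Lemma lapart_pack x la mu : lapart (pack x la mu) = la.
Proof. by rewrite /lapart /pack row_mxKl row_mxKr. Qed.
Lemma mupart_pack x la mu : mupart (pack x la mu) = mu.
Proof. by rewrite /mupart /pack row_mxKr. Qed.
Lemma pack_parts z : pack (xpart z) (lapart z) (mupart z) = z.
Proof. by rewrite /pack !hsubmxK. Qed.

Lemma xpart_linear : linear xpart.
Proof. by move=> a u v; rewrite /xpart !linearP. Qed.
Lemma lapart_linear : linear lapart.
Proof. by move=> a u v; rewrite /lapart !linearP. Qed.
Lemma mupart_linear : linear mupart.
Proof. by move=> a u v; rewrite /mupart !linearP. Qed.
HB.instance Definition _ := GRing.isLinear.Build _ _ _ _ xpart xpart_linear.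
HB.instance Definition _ := GRing.isLinear.Build _ _ _ _ lapart lapart_linear.
HB.instance Definition _ := GRing.isLinear.Build _ _ _ _ mupart mupart_linear.

Definition objz (z : 'rV[R]_n * 'rV[R]_d) := objective P z.1 z.2.
Definition ineqz i (z : 'rV[R]_n * 'rV[R]_d) := ineq P i z.1 z.2.
Definition eqcz j (z : 'rV[R]_n * 'rV[R]_d) := eqc P j z.1 z.2.

(** The data depends on the variable and the parameter but not on the
multipliers. *)
Definition xw (q : 'rV[R]_N * 'rV[R]_d) : 'rV[R]_n * 'rV[R]_d := (xpart q.1, q.2).
Lemma xw_linear : linear xw.
Proof. by move=> a u v; rewrite /xw/= linearP. Qed.
HB.instance Definition _ := GRing.isLinear.Build _ _ _ _ xw xw_linear.

(** The [j]-th partial derivative of the Lagrangian, written with differentials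
of the data jointly in the variable and the parameter. This form shows that it
is C^1 in all arguments and affine in the multipliers. *)
Definition stationarity (j : 'I_n) (q : 'rV[R]_N * 'rV[R]_d) : R :=
  'd objz (xw q) (delta_mx 0 j, 0)
  + \sum_(i < m) lapart q.1 0 i * 'd (ineqz i) (xw q) (delta_mx 0 j, 0)
  + \sum_(i < p) mupart q.1 0 i * 'd (eqcz i) (xw q) (delta_mx 0 j, 0).

(** For an active constraint the equation is [g_i = 0], for an inactive one
[la_i = 0]. Compared with the products [la_i * g_i] this choice keeps the
Jacobian simple. *)
Definition kktmap (A : {set 'I_m}) (q : 'rV[R]_N * 'rV[R]_d) : 'rV[R]_N :=
  pack (\row_j stationarity j q)
       (\row_i if i \in A then ineqz i (xw q) else lapart q.1 0 i)
       (\row_j eqcz j (xw q)).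

Variable D : set 'rV[R]_d.
Hypotheses (oD : open D) (C2 : nlp_Ck P 2 D).

Lemma open_cylinder (V : normedModType R) : open (@cylinder V _ D).
Proof.
by apply: (@open_comp _ _ (@snd V 'rV[R]_d)) => // q _; exact: cvg_snd.
Qed.

Lemma xw_continuous : continuous xw.
Proof.
move=> q.
have c1 : {for q, continuous (xpart \o fst)}.
  by apply: continuous_comp; [exact: cvg_fst|exact: rV_linear_continuous].
have c2 : {for q, continuous snd} by exact: cvg_snd.
exact: (cvg_pair c1 c2).
Qed.

Lemma C1_xw (phi : 'rV[R]_n * 'rV[R]_d -> R) : Ck 1 (cylinder D) phi -> Ck 1 (cylinder D) (phi \o xw).
Proof.
by move=> C; apply: (C1_comp_linr (f := xw) xw_continuous (@open_cylinder _) _ C).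
Qed.

(** Continuity of the differential comes from its own differentiability. *)
Lemma Ck_le1 (V W : normedModType R) (E : set V) (phi : V -> W) :
  Ck 2 E phi -> Ck 1 E phi.
Proof.
move=> [dphi C]; split=> // v x Ex.
by have [+ _] := C v => /(_ x Ex); exact: differentiable_continuous.
Qed.

Lemma C1_part k (L : {linear 'rV[R]_N -> 'rV[R]_k}) i :
  Ck 1 (cylinder D) (fun q => L q.1 0 i).
Proof.
pose l (q : 'rV[R]_N * 'rV[R]_d) : R := L q.1 0 i.
have llin : linear l by move=> a u v; rewrite /l/= linearP !mxE.
pose lL : {linear ('rV[R]_N * 'rV[R]_d)%type -> R} :=
  HB.pack l (GRing.isLinear.Build _ _ _ _ l llin).
apply: (@C1_lin R _ _ (cylinder D) lL); last exact: open_cylinder.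
move=> q; apply: (@continuous_comp _ _ _ (fun q => L q.1) (fun u => u 0 i)).
  by apply: (@continuous_comp _ _ _ fst L); [exact: cvg_fst|exact: rV_linear_continuous].
exact: coord_continuous.
Qed.

Lemma stationarity_C1 j : Ck 1 (cylinder D) (stationarity j).
Proof.
have [C2f C2g C2h] := C2; have oD1 := @open_cylinder 'rV[R]_N.
apply: C1D => //; first apply: C1D => //.
- by apply: (C1_xw (phi := fun z => 'd objz z (delta_mx 0 j, 0))); have [_] := C2f; exact.
- apply: C1_sum => // i; apply: C1M => //; first exact: C1_part.
  by apply: (C1_xw (phi := fun z => 'd (ineqz i) z (delta_mx 0 j, 0))); have [_] := C2g i; exact.
- apply: C1_sum => // i; apply: C1M => //; first exact: C1_part.
  by apply: (C1_xw (phi := fun z => 'd (eqcz i) z (delta_mx 0 j, 0))); have [_] := C2h i; exact.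
Qed.

Lemma kktmap_C1 A : Ck 1 (cylinder D) (kktmap A).
Proof.
have [C2f C2g C2h] := C2; have oD1 := @open_cylinder 'rV[R]_N.
have row k (F : 'I_k -> 'rV[R]_N * 'rV[R]_d -> R) : (forall i, Ck 1 (cylinder D) (F i)) ->
    forall i, Ck 1 (cylinder D) (fun q => (\row_j F j q) 0 i).
  by move=> CF i; under [X in Ck 1 (cylinder D) X]funext do rewrite mxE; exact: CF.
apply: C1_row => //; apply: C1_row_mx => //; first apply: C1_row_mx => //.
- by apply: row; exact: stationarity_C1.
- apply: row => i; case: (i \in A); last exact: C1_part.
  by apply: C1_xw; apply: Ck_le1; exact: C2g.
- by apply: row => i; apply: C1_xw; apply: Ck_le1; exact: C2h.
Qed.

Lemma diff_xsection (phi : 'rV[R]_n * 'rV[R]_d -> R) x w v : Ck 2 (cylinder D) phi -> D w ->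
  differentiable (fun y => phi (y, w)) x /\
  'd (fun y => phi (y, w)) x v = 'd phi (x, w) (v, 0).
Proof. by move=> [dphi _] Dw; apply: partial_diff; exact: dphi. Qed.

Lemma derive_lagrangian x la mu w j : D w ->
  'D_(delta_mx 0 j) (fun y => lagrangian P y la mu w) x =
  stationarity j (pack x la mu, w).
Proof.
move=> Dw; have [C2f C2g C2h] := C2.
have -> := @derive_lagrange R _ m p (fun y => objz (y, w)) (fun i y => ineqz i (y, w))
  (fun j y => eqcz j (y, w)) (fun i => la 0 i) (fun j => mu 0 j) x (delta_mx 0 j)
  (diff_xsection x 0 C2f Dw).1 (fun i => (diff_xsection x 0 (C2g i) Dw).1)
  (fun j => (diff_xsection x 0 (C2h j) Dw).1).
rewrite /stationarity /xw -[(_, w).1]/(pack x la mu) -[(_, w).2]/w xpart_pack lapart_pack mupart_pack.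
rewrite [X in X + _ + _](diff_xsection x _ C2f Dw).2.
congr (_ + _ + _); apply: eq_bigr => i _; congr (_ * _).
- exact: (diff_xsection x _ (C2g i) Dw).2.
- exact: (diff_xsection x _ (C2h i) Dw).2.
Qed.

(** The direction splits into a part along the variable, where stationarity is
the gradient of the Lagrangian with frozen multipliers and gives the Hessian,
and a part along the multipliers, in which stationarity is affine. *)
Lemma diff_stationarity x la mu w dx dla dmu j : D w ->
  'd (stationarity j) (pack x la mu, w) (pack dx dla dmu, 0) =
  (dx *m hess (fun y => lagrangian P y la mu w) x) 0 j
  + \sum_(i < m) dla 0 i * 'd (ineqz i) (x, w) (delta_mx 0 j, 0)
  + \sum_(i < p) dmu 0 i * 'd (eqcz i) (x, w) (delta_mx 0 j, 0).
Proof.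
move=> Dw; have [dS _] := stationarity_C1 j.
have dS0 := dS (pack x la mu, w) Dw.
have -> : (pack dx dla dmu, (0 : 'rV[R]_d)) =
    (pack dx 0 0, 0) + (pack 0 dla dmu, 0).
  by rewrite pairDE addr0 /pack !add_row_mx !addr0 !add0r.
rewrite [LHS]linearD -addrA; congr (_ + _).
- pose l y : 'rV[R]_N * 'rV[R]_d := (pack y 0 0, 0).
  have llin : linear l.
    move=> a u v; rewrite /l -[a *: (_, _)]/(a *: pack u 0 0, a *: 0) scaler0 pairDE addr0.
    by rewrite /pack !scale_row_mx !add_row_mx !scaler0 !addr0.
  pose L : {linear 'rV[R]_n -> ('rV[R]_N * 'rV[R]_d)%type} :=
    HB.pack l (GRing.isLinear.Build _ _ _ _ l llin).
  have cL : continuous L by exact: rV_linear_continuous.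
  have lE y : (pack 0 la mu, w) + L y = (pack y la mu, w).
    by rewrite pairDE addr0 /pack !add_row_mx !add0r !addr0.
  have dcl : differentiable (stationarity j) ((pack 0 la mu, w) + L x) by rewrite lE.
  have [dSx dSxE] := diff_affine dx cL dcl.
  rewrite lE in dSxE; rewrite -[LHS]dSxE.
  have E : (fun y => stationarity j ((pack 0 la mu, w) + L y)) =
      (fun y => 'D_(delta_mx 0 j) (fun y => lagrangian P y la mu w) y).
    by apply/funext => y; rewrite lE derive_lagrangian.
  rewrite E in dSx *.
  rewrite {1}[dx]row_sum_delta linear_sum !mxE; apply: eq_bigr => i _.
  by rewrite linearZ mxE deriveE.
- apply: diff_affine_line => // t.
  rewrite -[t *: (_, _)]/(t *: pack 0 dla dmu, t *: 0) scaler0 pairDE addr0.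
  have -> : pack x la mu + t *: pack 0 dla dmu = pack x (la + t *: dla) (mu + t *: dmu).
    by rewrite /pack !scale_row_mx !add_row_mx scaler0 addr0.
  rewrite /stationarity /xw.
  rewrite -[(pack _ (_ + _) _, w).1]/(pack _ _ _) -[(pack _ (_ + _) _, w).2]/w.
  rewrite -[(pack x la mu, w).1]/(pack _ _ _) -[(pack x la mu, w).2]/w.
  rewrite !xpart_pack !lapart_pack !mupart_pack.
  have sumE k (u du : 'rV[R]_k) (c : 'I_k -> R) :
      \sum_(i < k) (u + t *: du) 0 i * c i
      = \sum_(i < k) u 0 i * c i + t * \sum_(i < k) du 0 i * c i.
    rewrite mulr_sumr -big_split; apply: eq_bigr => i _.
    by rewrite !mxE mulrDl mulrA.
  rewrite !sumE mulrDr; set s1 := \sum_(i < m) _; set s2 := \sum_(i < p) _.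
  by rewrite !addrA; congr (_ + _); rewrite addrAC.
Qed.

Lemma dotv_grad k (phi : 'rV[R]_k -> R) x v : differentiable phi x ->
  dotv (grad phi x) v = 'd phi x v.
Proof.
move=> dphi; rewrite {2}[v]row_sum_delta linear_sum /dotv.
by apply: eq_bigr => i _; rewrite linearZ mxE deriveE// mulrC.
Qed.

Lemma dotv_grad_section (phi : 'rV[R]_n * 'rV[R]_d -> R) x w v :
  Ck 2 (cylinder D) phi -> D w ->
  dotv (grad (fun y => phi (y, w)) x) v = 'd phi (x, w) (v, 0).
Proof.
move=> Cphi Dw; have [dphi <-] := diff_xsection x v Cphi Dw.
exact: dotv_grad.
Qed.

End KKTSystem.

(** * Nondegeneracy of the KKT system *)

Lemma dotvE (R : realType) (n : nat) (u v : 'rV[R]_n) :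
  (u *m v^T) 0 0 = dotv u v.
Proof. by rewrite mxE /dotv; apply: eq_bigr => i _; rewrite mxE. Qed.

(** A nonzero coefficient would put the head of the list in the span of its
tail. *)
Lemma free_map_coef (K : fieldType) (V : vectType K) (I : eqType) (l : seq I)
    (G : I -> V) (k : I -> K) : free [seq G i | i <- l] ->
  \sum_(i <- l) k i *: G i = 0 -> forall i, i \in l -> k i = 0.
Proof.
elim: l => [//|a l IH]; rewrite /= free_cons => /andP[Ga fl].
rewrite big_cons => E.
have ka : k a = 0.
  apply: contraNeq Ga => ka.
  have -> : G a = (k a)^-1 *: (- \sum_(i <- l) k i *: G i).
    by move/eqP: E; rewrite addr_eq0 => /eqP <-; rewrite scalerA mulVf// scale1r.
  apply/rpredZ/rpredNr; rewrite big_seq; apply: rpred_sum => i il.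
  by apply/rpredZ/memv_span/map_f.
move: E; rewrite ka scale0r add0r => E i.
by rewrite inE => /predU1P[->//|]; exact: IH.
Qed.

(** Pairing the linearised stationarity with [dx] kills every term but the
quadratic one: for active [i] the vector [Gg i] is orthogonal to [dx], for
inactive [i] the coefficient [dla_i] is zero, and [Gh j] is orthogonal to [dx].
So [dx H dx^T = 0], and second-order sufficiency forces [dx = 0]. What remains
of stationarity is a linear relation between independent gradients. *)
Lemma KKT_system_nondegenerate (R : realType) (n m p : nat) (H : 'M[R]_n)
    (A : {set 'I_m}) (Gg : 'I_m -> 'rV[R]_n) (Gh : 'I_p -> 'rV[R]_n)
    (dx : 'rV[R]_n) (dla : 'rV[R]_m) (dmu : 'rV[R]_p) :
  free ([seq Gg i | i <- enum A] ++ [seq Gh j | j <- enum 'I_p]) ->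
  (dx != 0 -> (forall i, i \in A -> dotv (Gg i) dx = 0) ->
    (forall j, dotv (Gh j) dx = 0) -> 0 < (dx *m H *m dx^T) 0 0) ->
  dx *m H + \sum_(i < m) dla 0 i *: Gg i + \sum_(j < p) dmu 0 j *: Gh j = 0 ->
  (forall i, i \in A -> dotv (Gg i) dx = 0) ->
  (forall i, i \notin A -> dla 0 i = 0) ->
  (forall j, dotv (Gh j) dx = 0) ->
  [/\ dx = 0, dla = 0 & dmu = 0].
Proof.
move=> licq sosc stat dg dlaA dh.
have quad0 : (dx *m H *m dx^T) 0 0 = 0.
  have E : ((dx *m H + \sum_(i < m) dla 0 i *: Gg i + \sum_(j < p) dmu 0 j *: Gh j)
      *m dx^T) 0 0 = 0 by rewrite stat mul0mx mxE.
  move: E; rewrite !mulmxDl !mulmx_suml.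
  rewrite [X in X = _ -> _]mxE [X in X + _ = _ -> _]mxE !summxE.
  rewrite big1 => [|i _]; last first.
    rewrite -scalemxAl mxE dotvE.
    by have [/dg->|/dlaA->] := boolP (i \in A); rewrite ?mulr0 ?mul0r.
  rewrite big1 => [|j _]; last by rewrite -scalemxAl mxE dotvE dh mulr0.
  by rewrite !addr0.
have dx0 : dx = 0.
  apply/eqP; apply/negP => /negP dx_neq0.
  by have := sosc dx_neq0 dg dh; rewrite quad0 ltxx.
move: stat; rewrite dx0 mul0mx add0r => stat.
(* One index type for both families of gradients. *)
pose G (k : 'I_m + 'I_p) := match k with inl i => Gg i | inr j => Gh j end.
pose c (k : 'I_m + 'I_p) := match k with inl i => dla 0 i | inr j => dmu 0 j end.
have c0 : forall k, k \in [seq inl i | i <- enum A] ++ [seq inr j | j <- enum 'I_p] ->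
    c k = 0.
  apply: (@free_map_coef _ _ _ _ G).
    by rewrite map_cat -(map_comp G inl) -(map_comp G inr).
  rewrite big_cat !big_map !big_enum /= -[RHS]stat; congr (_ + _).
  rewrite big_mkcond; apply: eq_bigr => i _.
  by case: ifPn => // /dlaA ->; rewrite scale0r.
split=> //.
- apply/rowP => i; rewrite mxE.
  have [iA|/dlaA//] := boolP (i \in A).
  by apply: (c0 (inl i)); rewrite mem_cat map_f ?mem_enum.
- apply/rowP => j; rewrite mxE; apply: (c0 (inr j)).
  by rewrite mem_cat orbC map_f ?mem_enum.
Qed.

(** Each coordinate of the differential of [kktmap] is computed separately. A
multiplier which is not zero belongs to an active constraint, by
complementarity, so [dx] satisfies all the conditions of the critical cone. *)
Lemma kktmap_regular (R : realType) (n m p d : nat) (P : nlp R n m p d)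
    (D : set 'rV[R]_d) (w : 'rV[R]_d) (x : 'rV[R]_n) (la : 'rV[R]_m)
    (mu : 'rV[R]_p) :
  open D -> nlp_Ck P 2 D -> D w -> KKT P w (x, la, mu) -> LICQ P w x ->
  SOSC P w (x, la, mu) ->
  forall v, 'd (kktmap P (active P w x)) (pack x la mu, w) (v, 0) = 0 -> v = 0.
Proof.
move=> oD C2 Dw kkt licq sosc v.
rewrite -(pack_parts v); set dx := xpart v; set dla := lapart v; set dmu := mupart v.
set A := active P w x; set q0 := (pack x la mu, w) => dF0.
have [_ C2g C2h] := C2.
have [dF _] := kktmap_C1 oD C2 A; have dFq0 := dF q0 Dw.
have comp k F : (forall q, kktmap P A q 0 k = F q) ->
    differentiable F q0 /\ 'd F q0 (pack dx dla dmu, 0) = 0.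
  move=> EF; have [] := diff_coord (pack dx dla dmu, 0) k dFq0.
  have -> : (fun q => kktmap P A q 0 k) = F by apply/funext.
  by move=> ? ->; rewrite dF0 mxE.
have Exw : xw q0 = (x, w) by rewrite /xw /q0 -[(_, w).1]/(pack x la mu) xpart_pack.
have xwE : xw (pack dx dla dmu, (0 : 'rV[R]_d)) = (dx, 0).
  by rewrite /xw -[(_, 0).1]/(pack dx dla dmu) xpart_pack.
have compxw phi k : Ck 2 (cylinder D) phi -> (forall q, kktmap P A q 0 k = phi (xw q)) ->
    'd phi (x, w) (dx, 0) = 0.
  move=> [dphi _] /comp[_].
  have dxw : differentiable (@xw R n m p d) q0.
    by apply: linear_differentiable; exact: xw_continuous.
  have dphi0 : differentiable phi (xw q0) by rewrite Exw; exact: dphi.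
  have -> : 'd (phi \o @xw R n m p d) q0 = 'd phi (xw q0) \o 'd (@xw R n m p d) q0 :> (_ -> _).
    exact: diff_comp.
  rewrite (diff_lin _ (@xw_continuous R n m p d)).
  by rewrite -[X in X = _ -> _]/('d phi (xw q0) (xw (pack dx dla dmu, 0))) Exw xwE.
have dg i : i \in A -> dotv (grad (fun y => ineq P i y w) x) dx = 0.
  move=> iA; rewrite (dotv_grad_section (phi := ineqz P i) x dx (C2g i) Dw).
  apply: (compxw _ (lshift p (rshift n i))) => [|q]; first exact: C2g.
  by rewrite /kktmap /pack row_mxEl row_mxEr mxE iA.
have dh j : dotv (grad (fun y => eqc P j y w) x) dx = 0.
  rewrite (dotv_grad_section (phi := eqcz P j) x dx (C2h j) Dw).
  apply: (compxw _ (rshift (n + m) j)) => [|q]; first exact: C2h.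
  by rewrite /kktmap /pack row_mxEr mxE.
have dlaA i : i \notin A -> dla 0 i = 0.
  move=> iA; have [|dl <-] := comp (lshift p (rshift n i)) (fun q => lapart q.1 0 i).
    by move=> q; rewrite /kktmap /pack row_mxEl row_mxEr mxE (negbTE iA).
  apply/esym/diff_affine_line => // t.
  rewrite -[(q0 + _).1]/(pack x la mu + t *: pack dx dla dmu) -[q0.1]/(pack x la mu).
  by rewrite addrC lapart_linear !lapart_pack addrC [LHS]mxE [X in _ + X = _]mxE.
have stat : dx *m hess (fun y => lagrangian P y la mu w) x
    + \sum_(i < m) dla 0 i *: grad (fun y => ineq P i y w) x
    + \sum_(j < p) dmu 0 j *: grad (fun y => eqc P j y w) x = 0.
  apply/rowP => j; rewrite [LHS]mxE [X in X + _ = _]mxE !summxE [RHS]mxE.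
  have [|_] := comp (lshift p (lshift m j)) (stationarity P j).
    by move=> q; rewrite /kktmap /pack !row_mxEl mxE.
  rewrite (diff_stationarity oD C2 _ _ _ _ _ _ _ Dw) => E; rewrite -[RHS]E.
  congr (_ + _ + _); apply: eq_bigr => i _; rewrite !mxE; congr (_ * _).
  - have [dphi <-] := diff_xsection x (delta_mx 0 j) (C2g i) Dw.
    exact: deriveE.
  - have [dphi <-] := diff_xsection x (delta_mx 0 j) (C2h i) Dw.
    exact: deriveE.
have [_ kktg _] := kkt.
have [|-> -> ->] := KKT_system_nondegenerate licq _ stat dg dlaA dh.
  move=> dx0 _ _; apply: sosc => // i.
    by move=> iA; rewrite dg.
  move=> la0; apply: dg; rewrite inE; have [_ _ /eqP] := kktg i.
  by rewrite mulf_eq0 (negbTE la0).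
by rewrite /pack !row_mx0.
Qed.

(** * Equivalence with the KKT conditions near a strictly complementary triple *)

(** The strict inequalities which make the sign conditions and the
complementarity products equivalent to equations. *)
Definition strict_pattern (R : realType) (n m p d : nat) (P : nlp R n m p d)
    (A : {set 'I_m}) : set ('rV[R]_(n + m + p) * 'rV[R]_d) :=
  [set q | forall i, if i \in A then 0 < lapart q.1 0 i
                     else ineqz P i (xw q) < 0].

Lemma kktmap_eq0 (R : realType) (n m p d : nat) (P : nlp R n m p d)
    (A : {set 'I_m}) (D : set 'rV[R]_d) (x : 'rV[R]_n) (la : 'rV[R]_m)
    (mu : 'rV[R]_p) (w : 'rV[R]_d) :
  nlp_Ck P 2 D -> D w -> strict_pattern P A (pack x la mu, w) ->
  KKT P w (x, la, mu) <-> kktmap P A (pack x la mu, w) = 0.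
Proof.
move=> C2 Dw; rewrite /strict_pattern /= /xw /= lapart_pack xpart_pack => sp.
have grad0 : grad (fun y => lagrangian P y la mu w) x =
    \row_j stationarity P j (pack x la mu, w).
  by apply/rowP => j; rewrite !mxE (derive_lagrangian C2).
have pack0 a b c : pack a b c = 0 <-> [/\ a = 0, b = 0 & c = 0].
  split=> [E|[-> -> ->]]; last by rewrite /pack !row_mx0.
  split; [rewrite -(xpart_pack a b c)|rewrite -(lapart_pack a b c)|
    rewrite -(mupart_pack a b c)]; by rewrite E linear0.
rewrite /kktmap pack0 -grad0 /xw /= lapart_pack xpart_pack.
split=> [[g0 gla h0]|[g0 /rowP gla /rowP h0]]; split=> //.
- apply/rowP => i; rewrite !mxE; have [_ _ /eqP] := gla i.
  by have := sp i; case: ifP => _ spi; rewrite mulf_eq0 => /orP[] /eqP E //;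
    move: spi; rewrite /ineqz/= E ltxx.
- by apply/rowP => j; rewrite !mxE; exact: h0.
- move=> i; have := gla i; rewrite !mxE; have := sp i.
  case: ifP => _ spi; rewrite /ineqz/= in spi * => E; rewrite E ?mulr0 ?mul0r.
    by split; rewrite // ltW.
  by split; rewrite // ltW.
- by move=> j; have := h0 j; rewrite !mxE.
Qed.

(** Strict complementarity and complementary slackness make all the inequalities
strict at the base point; they persist by continuity. *)
Lemma strict_pattern_nbhs (R : realType) (n m p d : nat) (P : nlp R n m p d)
    (D : set 'rV[R]_d) (x : 'rV[R]_n) (la : 'rV[R]_m) (mu : 'rV[R]_p)
    (w : 'rV[R]_d) :
  open D -> nlp_Ck P 2 D -> D w -> KKT P w (x, la, mu) ->
  strict_complementarity P w x la ->
  nbhs (pack x la mu, w) (strict_pattern P (active P w x)).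
Proof.
move=> oD C2 Dw [_ kktg _] sc.
have cphi (phi : 'rV[R]_(n + m + p) * 'rV[R]_d -> R) :
    Ck 1 (cylinder D) phi -> phi q @[q --> (pack x la mu, w)] --> phi (pack x la mu, w).
  by move=> [dphi _]; exact/differentiable_continuous/dphi.
have FF : Filter (nbhs (pack x la mu, w)) by exact: nbhs_filter.
apply: (@filter_forall _ _ (fun i q => if i \in active P w x
  then 0 < lapart q.1 0 i else ineqz P i (xw q) < 0) _ FF) => i.
have [iA|iA] := boolP (i \in active P w x).
  apply: (cvgr_gt _ (cphi (fun q => lapart q.1 0 i) _)); first exact: C1_part.
  by rewrite -[(_, w).1]/(pack x la mu) lapart_pack; exact: sc.
apply: (cvgr_lt _ (cphi (fun q => ineqz P i (xw q)) _)).
  by apply: C1_xw => //; have [_ C2g _] := C2; apply: Ck_le1; exact: C2g.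
rewrite /xw -[(_, w).1]/(pack x la mu) -[(_, w).2]/w xpart_pack.
have [gi _ _] := kktg i; rewrite lt_neqAle gi andbT.
by move: iA; rewrite inE.
Qed.

Lemma unpack_C1 (R : realType) (n m p : nat) (W : normedModType R) (U : set W)
    (s : W -> 'rV[R]_(n + m + p)) : open U -> Ck 1 U s ->
  Ck 1 U (fun w => (xpart (s w), lapart (s w), mupart (s w))).
Proof.
move=> oU C1s.
pose l (z : 'rV[R]_(n + m + p)) := (xpart z, lapart z, mupart z).
have llin : linear l by move=> a u v; rewrite /l !linearP.
pose L : {linear 'rV[R]_(n + m + p) -> ('rV[R]_n * 'rV[R]_m * 'rV[R]_p)%type} :=
  HB.pack l (GRing.isLinear.Build _ _ _ _ l llin).
have cL : continuous L by exact: rV_linear_continuous.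
exact: (C1_comp_linl cL oU C1s).
Qed.

Lemma pack_continuous (R : realType) (n m p : nat) (W : normedModType R)
    (s : W -> 'rV[R]_n * 'rV[R]_m * 'rV[R]_p) (w : W) :
  {for w, continuous s} ->
  {for w, continuous (fun w => pack (s w).1.1 (s w).1.2 (s w).2)}.
Proof.
move=> cs.
pose l (z : 'rV[R]_n * 'rV[R]_m * 'rV[R]_p) := pack z.1.1 z.1.2 z.2.
have llin : linear l.
  move=> a u v; rewrite /l.
  by rewrite /pack !scale_row_mx !add_row_mx.
pose L : {linear ('rV[R]_n * 'rV[R]_m * 'rV[R]_p)%type -> 'rV[R]_(n + m + p)} :=
  HB.pack l (GRing.isLinear.Build _ _ _ _ l llin).
have cL : continuous L.
  apply: (@linear_le_continuous _ _ _ _ 1) => -[[x la] mu]; rewrite mul1r.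
  have := lexx `|(x, la, mu)|; rewrite {1}pair_norm_le => /andP[+ muE].
  rewrite {1}pair_norm_le => /andP[xE laE].
  by apply: row_mx_norm_le => //; exact: row_mx_norm_le.
exact: (continuous_comp cs (cL _)).
Qed.

(** * Euclidean norms and regimes *)

Lemma enorm_ge0 (R : realType) (n : nat) (u : 'rV[R]_n) : 0 <= enorm u.
Proof. exact: sqrtr_ge0. Qed.

Lemma norm_le_enorm (R : realType) (n : nat) (u : 'rV[R]_n) : `|u| <= enorm u.
Proof.
apply: rV_norm_le => [|i]; first exact: enorm_ge0.
rewrite -sqrtr_sqr; apply: ler_wsqrtr; rewrite expr2 /dotv (bigD1 i)//= lerDl.
by apply: sumr_ge0 => j _; rewrite -expr2 sqr_ge0.
Qed.

(** Here [`|u|] is the sup norm. *)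
Lemma enorm_le_norm (R : realType) (n : nat) (u : 'rV[R]_n) :
  enorm u <= Num.sqrt n%:R * `|u|.
Proof.
have -> : Num.sqrt n%:R * `|u| = Num.sqrt (n%:R * `|u| ^+ 2).
  by rewrite sqrtrM// sqrtr_sqr ger0_norm.
apply: ler_wsqrtr; rewrite /dotv.
have -> : n%:R * `|u| ^+ 2 = \sum_(i < n) `|u| ^+ 2.
  by rewrite sumr_const card_ord mulr_natl.
apply: ler_sum => i _; rewrite -expr2 -real_normK ?num_real//.
by apply: lerXn2r; rewrite ?nnegrE// rV_coord_le_norm.
Qed.

Lemma core_region_inj (R : realType) (m : nat) (T : params R) (la : 'rV[R]_m)
    (r r' : core_regime) :
  core_region T r la -> core_region T r' la -> r = r'.
Proof.
move=> [_ +] [_]; case: r; case: r' => //=.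
all: intros; repeat match goal with
  | H : _ /\ _ |- _ => destruct H
  | H : and3 _ _ _ |- _ => destruct H
  | H : and4 _ _ _ _ |- _ => destruct H end; exfalso; lra.
Qed.

Lemma Psi_core (R : realType) (m : nat) (T : params R) (la : 'rV[R]_m)
    (r : core_regime) : core_region T r la -> Psi T la = Core r.
Proof.
move=> rla; rewrite /Psi; case: pselect => [H|]; last first.
  by case; exists r; split => // r' r'la; exact: core_region_inj rla r'la.
by congr Core; have [rc _] := svalP (cid H); exact: core_region_inj rc rla.
Qed.

(** The infimum defining the distance is attained at the point itself. *)
Lemma margin_boundary (R : realType) (m : nat) (T : params R) (la : 'rV[R]_m)
    (r : core_regime) :
  orthant_boundary (core_region T r) la -> margin T r la = 0.
Proof.
move=> bla; set S := [set enorm (la - v) | v in orthant_boundary (core_region T r)].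
have S0 : S 0.
  exists la => //; rewrite subrr /enorm /dotv big1 ?sqrtr0// => i _.
  by rewrite mxE mul0r.
have lbS : lbound S 0 by move=> _ [v _ <-]; exact: enorm_ge0.
apply/eqP; rewrite eq_le; apply/andP; split.
  by apply: ge_inf => //; exists 0.
by apply: lb_le_inf => //; exists 0.
Qed.

(** At most one core region contains [la], and only it matters. If [la] is not on
its relative boundary, a neighbourhood of [la] meets no nonnegative multiplier
outside the region. *)
Lemma core_region_radius (R : realType) (m : nat) (T : params R)
    (la : 'rV[R]_m) : exists2 e, 0 < e & forall r, core_region T r la ->
    orthant_boundary (core_region T r) la \/
    forall la', nonneg_orthant la' -> enorm (la' - la) < e ->
      core_region T r la'.
Proof.
have [[r [rla nb]]|H] := pselect (exists r, core_region T r la /\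
    ~ orthant_boundary (core_region T r) la); last first.
  exists 1 => // r rla; left; apply: contrapT => nb.
  by apply: H; exists r.
have : ~ closure (@nonneg_orthant R m `\` core_region T r) la.
  move=> cl; apply: nb; split => //; split; first by have [] := rla.
  exact: (subset_closure rla).
move=> /existsNP[B /not_implyP[/nbhs_normP[e /= e0 eB] Bdisj]].
exists e => // r' r'la; right => la' la'0 la'e.
have <- := core_region_inj rla r'la.
apply: contrapT => nr; apply: Bdisj; exists la'; split; first by split.
by apply: eB; rewrite /ball_/= distrC (le_lt_trans (norm_le_enorm _)).
Qed.

(** * Strong regularity and constancy of the regime *)

Theorem theorem5 (R : realType) (n m p d : nat) (P : nlp R n m p d)
    (T : params R) (Omega0 : set 'rV[R]_d) (ws : 'rV[R]_d)
    (xs : 'rV[R]_n) (las : 'rV[R]_m) (mus : 'rV[R]_p) :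
  admissible m T ->
  open Omega0 -> Omega0 ws ->
  nlp_Ck P 2 Omega0 ->
  KKT P ws (xs, las, mus) ->
  LICQ P ws xs ->
  SOSC P ws (xs, las, mus) ->
  strict_complementarity P ws xs las ->
  exists (U : set 'rV[R]_d) (kappa eta0 : R),
    [/\ open U, U ws, U `<=` Omega0, 0 < kappa & 0 < eta0] /\
    let kkt_branch (s : 'rV[R]_d -> 'rV[R]_n * 'rV[R]_m * 'rV[R]_p) :=
      [/\ Ck 1 U s, s ws = (xs, las, mus) & forall w, U w -> KKT P w (s w)] in
    exists s : 'rV[R]_d -> 'rV[R]_n * 'rV[R]_m * 'rV[R]_p,
      [/\ kkt_branch s,
          forall s', kkt_branch s' -> forall w, U w -> s' w = s w,
          forall w, U w -> enorm ((s w).1.2 - las) <= kappa * enorm (w - ws) &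
          forall (r : core_regime), core_region T r las ->
          forall (N : set 'rV[R]_m) (CPsi : R),
            nbhs las N -> bounded_set N ->
            lipschitz_const (N `&` @nonneg_orthant R m) (feature T) = CPsi%:E ->
          let eta := Num.min eta0 (margin T r las / (CPsi * kappa)) in
          forall w, U w -> enorm (w - ws) < eta ->
            Psi T (s w).1.2 = Core r].
Proof.
move=> _ oO Ows C2 kkt licq sosc sc.
set A := active P ws xs; set z0 := pack xs las mus.
have sp_nbhs := strict_pattern_nbhs oO C2 Ows kkt sc.
have sp0 := nbhs_singleton sp_nbhs.
have F0 := (kktmap_eq0 C2 Ows sp0).1 kkt.
have [r [rho [K [t [[r0 rho0 K0 C1t] [t0 HO Ht Htu HtK]]]]]] :=
  @implicit_function R _ _ (kktmap P A) (cylinder Omega0) (strict_pattern P A)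
    z0 ws (@open_cylinder _ _ _ oO _) (kktmap_C1 oO C2 A) Ows sp_nbhs F0
    (kktmap_regular oO C2 Ows kkt licq sosc).
pose U := ball ws rho.
have Uws : U ws by exact: ballxx.
have oU : open U by exact: ball_open.
have UO w : U w -> Omega0 w.
  move=> Uw; have [|_ Dw] := HO z0 w _ Uw; first by rewrite subrr normr0 ltW.
  exact: Dw.
have KKT_iff z w : `|z - z0| <= r -> U w ->
    KKT P w (xpart z, lapart z, mupart z) <-> kktmap P A (z, w) = 0.
  move=> zr Uw; have [spz _] := HO z w zr Uw.
  rewrite -{4}[z]pack_parts; apply: (kktmap_eq0 C2 (UO _ Uw)).
  by rewrite pack_parts.
pose s w := (xpart (t w), lapart (t w), mupart (t w)).
have le2 z : `|z - z0| <= r / 2 -> `|z - z0| <= r.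
  by move=> /le_trans; apply; lra.
have s_kkt w : U w -> KKT P w (s w).
  by move=> Uw; have [/le2 tr tF] := Ht w Uw; exact/KKT_iff.
pose kappa := (Num.sqrt m%:R + 1) * K.
have kappa0 : 0 < kappa by rewrite mulr_gt0// ltr_wpDl// sqrtr_ge0.
have s_lip w : U w -> enorm ((s w).1.2 - las) <= kappa * enorm (w - ws).
  move=> Uw; rewrite /s/= -(lapart_pack xs las mus) -/z0 -linearB/=.
  apply: le_trans (enorm_le_norm _) _.
  rewrite /kappa -mulrA; apply: ler_pM; rewrite ?sqrtr_ge0//; first by rewrite lerDl.
  have le_t : `|lapart (t w - z0)| <= `|t w - z0|.
    by apply: rV_norm_le => // i; rewrite [lapart _ 0 i]mxE [X in `|X|]mxE; exact: rV_coord_le_norm.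
  apply: le_trans le_t _; apply: le_trans (HtK w Uw) _.
  by rewrite ler_pM2l// norm_le_enorm.
have [e e0 He] := core_region_radius T las.
exists U, kappa, (e / kappa); split; first by split; rewrite ?divr_gt0.
exists s; split.
- split=> //; first exact: unpack_C1.
  by rewrite /s t0 /z0 xpart_pack lapart_pack mupart_pack.
- move=> s' [[ds' _] s'0 s'kkt] w Uw.
  pose t' w := pack (s' w).1.1 (s' w).1.2 (s' w).2.
  have s't w' : s' w' = (xpart (t' w'), lapart (t' w'), mupart (t' w')).
    by rewrite /t' xpart_pack lapart_pack mupart_pack; case: (s' w') => -[].
  rewrite s't /s (_ : t' w = t w)//.
  apply: (@branch_unique _ _ _ (fun z w => KKT P w (xpart z, lapart z, mupart z))
    t t' z0 ws r rho r0) => //.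
  + by move=> w' /Ht[].
  + by move=> z w' zr Uw' /(KKT_iff _ _ zr Uw'); exact: Htu.
  + by move=> w' Uw'; apply/pack_continuous/differentiable_continuous/ds'.
  + by rewrite /t' s'0.
  + by move=> w' Uw'; rewrite -s't; exact: s'kkt.
- exact: s_lip.
- move=> rg rglas N CPsi _ _ _ eta w Uw; rewrite /eta lt_min => /andP[lt1 lt2].
  apply: Psi_core; have [/margin_boundary mg|Hin] := He rg rglas.
    by move: lt2; rewrite mg mul0r ltNge enorm_ge0.
  apply: Hin; last first.
    apply: le_lt_trans (s_lip w Uw) _.
    by rewrite -ltr_pdivlMl// mulrC.
  by move=> i; have [_ /(_ i)[]] := s_kkt w Uw.
Qed.
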